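(* Let $D$ be a directed set. For any ordinal $\xi$, any $n\in\mathbb{N}$, any $\delta\in(0,1)$, and any function $f:\Pi\Omega_{\xi,n}\to[-1,1]$, there exist a unit preserving extended pruning $(\theta,e):\Omega_{\xi,n}\to\Omega_{\xi,n}$ and an $n$-tuple $(a_i)_{i=1}^n\subset[-1,1]$ such that for each $1\leqslant i\leqslant n$, (i) for each $s\in\Lambda_{\xi,n,i}$ and $t\in MAX(\Omega_{\xi,n})$ with $s\preceq t$, $f(\theta(s),e(t))\geqslant a_i-\delta$, (ii) for each $t\in MAX(\Omega_{\xi,n})$, $$\sum_{\Lambda_{\xi,n,i}\ni s\preceq e(t)}\mathbb{P}_\xi(\iota_{\xi,n}(s))f(s,e(t))\leqslant\delta/n+a_i.$$ In particular, for every $t\in MAX(\Omega_{\xi,n})$, $\sum_{s\preceq e(t)}\mathbb{P}_\xi(\iota_{\xi,n}(s))f(s,e(t))\leqslant\delta+\sum_{i=1}^na_i$.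
   Context: Sequences are finite; $s\prec t$ ($s\preceq t$) means $s$ is a proper (not necessarily proper) initial segment of $t$; $s^\frown t$ is concatenation; $MAX(S)$ is the set of $\preceq$-maximal members of $S$; $\Pi S=\{(s,t)\in S\times S:s\preceq t\in MAX(S)\}$. For an ordinal $\zeta$ and a sequence of ordinals, $\zeta+(\zeta_i)_{i=1}^n=(\zeta+\zeta_i)_{i=1}^n$; $\zeta+S=\{\zeta+s:s\in S\}$. $\Gamma_0=\{(0)\}$; given $\Gamma_\xi$, $\Gamma_{\xi,1}=\Gamma_\xi$, $\Gamma_{\xi,n+1}=(\omega^\xi n+\Gamma_\xi)\cup\{t^\frown u:t\in MAX(\omega^\xi n+\Gamma_\xi),u\in\Gamma_{\xi,n}\}$, $\Gamma_{\xi+1}=\bigcup_{n\ge1}\Gamma_{\xi,n}$ (a disjoint union); for limit $\xi$, $\Gamma_\xi=\bigcup_{\zeta<\xi}(\omega^\zeta+\Gamma_{\zeta+1})$ (a disjoint union). For a set $S$ of sequences, $SD=\{((\zeta_i,U_i))_{i=1}^n:(\zeta_i)_{i=1}^n\in S,\ U_i\in D\}$, identified with pairs $(s,\sigma)$, $s\in S$, $\sigma$ a sequence in $D$ of the same length. $\Omega_\xi=\Gamma_\xi D$, $\Omega_{\xi,n}=\Gamma_{\xi,n}D$. Each $t\in\Omega_{\xi,n}$ is uniquely $((\omega^\xi(n-1)+t_1)^\frown\cdots^\frown(\omega^\xi(n-m)+t_m),\sigma)$ with $1\leqslant m\leqslant n$, $t_i\in\Gamma_\xi$, $t_i\in MAX(\Gamma_\xi)$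 for $i<m$; then $t$ is on level $m$, $\Lambda_{\xi,n,m}$ is the set of members of $\Omega_{\xi,n}$ on level $m$, and $\iota_{\xi,n}(t)=(t_m,\sigma_m)\in\Omega_\xi$, where $\sigma_m$ consists of the last $|t_m|$ terms of $\sigma$. A unit of $\Omega_{\xi,n}$ is either $\Lambda_{\xi,n,1}$ or, for some $1\leqslant m<n$ and $s\in MAX(\Lambda_{\xi,n,m})$, the set of all proper extensions of $s$ lying in $\Lambda_{\xi,n,m+1}$. $\mathbb{P}_\xi:\Omega_\xi\to[0,1]$: $\mathbb{P}_0((0,U))=1$; $\mathbb{P}_{\xi+1}(t)=\frac1n\mathbb{P}_\xi(\iota_{\xi,n}(t))$ for $t\in\Omega_{\xi,n}$; for limit $\xi$, $\mathbb{P}_\xi((\omega^\zeta+t',\sigma))=\mathbb{P}_{\zeta+1}((t',\sigma))$ for $\zeta<\xi$, $t'\in\Gamma_{\zeta+1}$. A map $\theta:S_1D\to S_2D$ is a pruning if $s\prec t$ implies $\theta(s)\prec\theta(t)$, and whenever $s$ has last term $(\zeta,U)$ and $\theta(s)$ has last term $(\zeta',U')$, $U\leqslant_DU'$. If moreover $e:MAX(S_1D)\to MAX(S_2D)$ satisfies $\theta(t)\preceq e(t)$ for all $t\in MAX(S_1D)$, $(\theta,e):S_1D\to S_2D$ is an extended pruning. An extended pruning $(\theta,e):\Omega_{\xi,n}\to\Omega_{\xi,n}$ is unit preserving if $\theta$ maps each unit into a single unit, and whenever $s\prec t$ lie on different levels of $\Omega_{\xi,n}$, so do $\theta(s),\theta(t)$.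 *)

(* Defs.v *)
From HB Require Import structures.
From mathcomp Require Import all_boot all_order all_algebra.
From mathcomp Require Import generic_quotient.
From mathcomp Require Import all_classical all_reals.

Set Implicit Arguments.
Unset Strict Implicit.
Unset Printing Implicit Defensive.

Import Order.TTheory GRing.Theory Num.Theory.

Local Open Scope quotient_scope.
Local Open Scope classical_set_scope.
Local Open Scope order_scope.

(** [node A f] denotes the least ordinal strictly greater than every [f a];
    ordinals are trees modulo mutual [tree_le].  The facts [Ord_wf] (together
    with the total order structure) and [Ord_bounded] below characterise [Ord]
    as the class of all ordinals of a universe. *)
Inductive tree : Type := node (A : Type) (f : A -> tree).

HB.instance Definition _ := gen_eqMixin tree.
HB.instance Definition _ := gen_choiceMixin tree.

Fixpoint tree_le (s t : tree) : Prop :=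
  match s, t with
  | node A f, node B g => forall a, exists b, tree_le (f a) (g b)
  end.

Definition tree_lt (s t : tree) : Prop :=
  match t with node B g => exists b, tree_le s (g b) end.

Lemma tree_le_refl t : tree_le t t.
Proof. by elim: t => A f IH /= a; exists a. Qed.

Lemma tree_le_trans s t u : tree_le s t -> tree_le t u -> tree_le s u.
Proof.
elim: s t u => A f IH [B g] [C h] /= st tu a.
have [b /IH {}st] := st a; have [c bc] := tu b.
by exists c; exact: st.
Qed.

Lemma tree_ltW s t : tree_lt s t -> tree_le s t.
Proof.
elim: s t => A f IH [B g] /= [b fb] a; exists b; apply: IH.
by case: (g b) fb => C h /(_ a).
Qed.

Lemma tree_le_sub A (f : A -> tree) t a : tree_le (node f) t -> tree_lt (f a) t.
Proof. by case: t => B g /(_ a). Qed.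

Lemma tree_lt_irr t : ~ tree_lt t t.
Proof. by elim: t => A f IH [a /(tree_le_sub a)/IH]. Qed.

Lemma tree_le_or_lt s t : tree_le s t \/ tree_lt t s.
Proof.
elim: s t => A f IH [B g].
have [|/existsNP[a /forallNP na]] :=
  pselect (forall a, exists b, tree_le (f a) (g b)); first by left.
right; exists a; case: (f a) (IH a) na => C h IHa na b.
by have [/na|] := IHa (g b).
Qed.

Definition tree_eq (s t : tree) : bool := `[< tree_le s t /\ tree_le t s >].

Lemma tree_eq_refl : reflexive tree_eq.
Proof. by move=> t; apply/asboolP; split; exact: tree_le_refl. Qed.

Lemma tree_eq_sym : symmetric tree_eq.
Proof. by move=> s t; apply/asboolP/asboolP => -[]. Qed.

Lemma tree_eq_trans : transitive tree_eq.
Proof.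
move=> t s u /asboolP[st ts] /asboolP[tu ut]; apply/asboolP.
by split; [exact: tree_le_trans tu|exact: tree_le_trans ts].
Qed.

Canonical tree_eq_equiv := EquivRel tree_eq tree_eq_refl tree_eq_sym tree_eq_trans.

Definition Ord : Type := {eq_quot tree_eq}.
HB.instance Definition _ := Choice.on Ord.
HB.instance Definition _ : EqQuotient _ tree_eq Ord := EqQuotient.on Ord.

Fact Ord_display : Order.disp_t. Proof. exact: Order.Disp tt tt. Qed.

Definition ole (a b : Ord) : bool := `[< tree_le (repr a) (repr b) >].

Fact ole_refl : reflexive ole.
Proof. by move=> a; apply/asboolP; exact: tree_le_refl. Qed.

Fact ole_anti : antisymmetric ole.
Proof.
move=> a b /andP[/asboolP ab /asboolP ba].
rewrite -[a]reprK -[b]reprK; apply/eqmodP.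
by apply/asboolP.
Qed.

Fact ole_trans : transitive ole.
Proof.
move=> b a c /asboolP ab /asboolP bc; apply/asboolP.
exact: tree_le_trans bc.
Qed.

HB.instance Definition _ :=
  Order.Le_isPOrder.Build Ord_display Ord ole_refl ole_anti ole_trans.

Fact ole_total : total ole.
Proof.
move=> a b; rewrite /ole; apply/orP.
have [ab|/tree_ltW ba] := tree_le_or_lt (repr a) (repr b).
  by left; apply/asboolP.
by right; apply/asboolP.
Qed.

HB.instance Definition _ :=
  Order.POrder_isTotal.Build Ord_display Ord ole_total.

Lemma repr_lt (a b : Ord) : a < b -> tree_lt (repr a) (repr b).
Proof.
rewrite ltNge => /negP nba.
by have [ba|//] := tree_le_or_lt (repr b) (repr a); case: nba; apply/asboolP.
Qed.

Lemma Ord_wf : well_founded (fun a b : Ord => a < b).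
Proof.
suff H t a : tree_le (repr a) t -> Acc (fun a b : Ord => a < b) a.
  by move=> a; apply: (H (repr a)); exact: tree_le_refl.
elim: t a => B g IH a at_; constructor => b /repr_lt.
case: (repr a) at_ => A f at_ [x bx].
by have [y xy] := at_ x; apply: (IH y); exact: tree_le_trans xy.
Qed.

(** Every family of ordinals indexed by a (small) type is bounded. *)
Lemma Ord_bounded (A : Type) (f : A -> Ord) : exists b, forall a, f a < b.
Proof.
pose t := node (fun a => repr (f a)).
exists (\pi_Ord t) => a; rewrite ltNge; apply/negP => /asboolP le_a.
have /eqmodP/asboolP[_ tr] : repr (\pi_Ord t) = t %[mod Ord] by rewrite reprK.
have tle := tree_le_trans tr le_a.
by apply: (@tree_lt_irr t); exists a.
Qed.

Lemma Ord_seg_bounded (F : Ord -> Ord) (a : Ord) :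
  exists c, forall b, b < a -> F b < c.
Proof.
have small (t : tree) : exists X : {A : Type & A -> Ord},
    forall b : Ord, tree_le (repr b) t -> exists x, b = projT2 X x.
  elim: t => B g /choice[X XP].
  exists (existT (fun A : Type => A -> Ord) (option {y & projT1 (X y)}) (fun o =>
    if o is Some (existT y x) then projT2 (X y) x
    else \pi_Ord (node g))) => b bg.
  have [gb|] := tree_le_or_lt (node g) (repr b).
    exists None; rewrite -[b]reprK; apply/eqmodP.
    by apply/asboolP; split.
  case=> y /XP[x ->]; by exists (Some (existT _ y x)).
have [[A f] fP] := small (repr a).
have [c cP] := Ord_bounded (fun x => F (f x)).
exists c => b /ltW/asboolP/fP[x ->]; exact: cP.
Qed.

Definition ord_rec (X : Type) (F : forall a, (forall b : Ord, b < a -> X) -> X)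
  : Ord -> X := Fix Ord_wf (fun=> X) F.

Lemma ord_recE X F a : @ord_rec X F a = F a (fun b _ => ord_rec F b).
Proof.
apply: (Fix_eq Ord_wf (fun=> X)) => b f g fg; congr F.
by apply: functional_extensionality_dep => c; apply: functional_extensionality_dep.
Qed.

Lemma ord_ind (P : Ord -> Prop) :
  (forall a, (forall b, b < a -> P b) -> P a) -> forall a, P a.
Proof. exact: well_founded_ind Ord_wf P. Qed.

Definition ozero : Ord := \pi_Ord (node (fun x : False => match x with end)).

Lemma ozero_le a : ozero <= a.
Proof.
apply/asboolP.
have /eqmodP/asboolP[+ _] : repr ozero =
  node (fun x : False => match x with end) %[mod Ord] by rewrite reprK.
by move/tree_le_trans; apply; case: (repr a) => A f /= [].
Qed.

(** The least element of [P]; a junk value when [P] is empty. *)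
Definition oleast (P : set Ord) : Ord :=
  xget ozero [set a | P a /\ forall b, P b -> a <= b].

Lemma oleastP (P : set Ord) a :
  P a -> P (oleast P) /\ forall b, P b -> oleast P <= b.
Proof.
suff ex : P a -> exists a0, P a0 /\ forall b, P b -> a0 <= b.
  by move=> /ex/(xgetPex ozero).
elim/ord_ind: a => a IH Pa.
have [[b [ba Pb]]|nb] := pselect (exists b, b < a /\ P b); first exact: IH ba Pb.
exists a; split=> // b Pb; rewrite leNgt; apply/negP => ba.
by apply: nb; exists b.
Qed.

Definition osucc (a : Ord) : Ord := oleast [set b | a < b].

Definition olimit (a : Ord) : Prop :=
  a <> ozero /\ forall b, b < a -> osucc b < a.

Lemma osucc_le a b : (osucc a <= b) = (a < b).
Proof.
have [c /(_ a) ac] : exists c, forall b, b < osucc a -> b < c.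
  by have [c] := Ord_seg_bounded id (osucc a); exists c.
have [c' /(_ tt) ac'] := Ord_bounded (fun _ : unit => a).
have [lt_succ least_succ] := @oleastP [set b | a < b] c' ac'.
apply/idP/idP => [|/least_succ//].
exact: lt_le_trans.
Qed.

Lemma lt_osucc a : a < osucc a. Proof. by rewrite -osucc_le. Qed.

Lemma lt_osuccE a b : (a < osucc b) = (a <= b).
Proof. by rewrite ltNge osucc_le -leNgt. Qed.

Lemma osucc_inj : injective osucc.
Proof.
by move=> a b ab; apply/le_anti; rewrite -lt_osuccE -ab lt_osucc -lt_osuccE ab lt_osucc.
Qed.

Lemma Ord_cases a : [\/ a = ozero, exists b, a = osucc b | olimit a].
Proof.
have [->|/eqP a0] := eqVneq a ozero; first by constructor 1.
have [|nex] := pselect (exists b, a = osucc b); first by constructor 2.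
constructor 3; split=> // b ba; rewrite lt_neqAle osucc_le ba andbT.
by apply/eqP => ab; apply: nex; exists b.
Qed.

(** [oadd a b] is the least ordinal that is at least [a] and strictly above
    [oadd a b'] for all [b' < b]. *)
Definition oadd (a : Ord) : Ord -> Ord :=
  ord_rec (fun b rec =>
    oleast [set c | a <= c /\ forall b' (lt_b : b' < b), rec b' lt_b < c]).

Lemma oadd_spec a b :
  [/\ a <= oadd a b, forall b', b' < b -> oadd a b' < oadd a b
    & forall c, a <= c -> (forall b', b' < b -> oadd a b' < c) -> oadd a b <= c].
Proof.
rewrite [in X in [/\ X, _ & _]]/oadd ord_recE -/(oadd a).
set Q := [set c | _].
have EQ : oadd a b = oleast Q by rewrite {1}/oadd ord_recE.
have [c cP] := Ord_seg_bounded (oadd a) b.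
have [] := @oleastP Q (Order.max a c).
  split=> [|b' /cP]; first by rewrite le_max lexx.
  by move=> h; rewrite lt_max h orbT.
move=> [h1 h2] h3; split=> //; first by move=> b'; rewrite EQ; apply: h2.
by move=> d ad db; rewrite EQ; apply: h3; split.
Qed.

Lemma ole_add a b : a <= oadd a b. Proof. by have [] := oadd_spec a b. Qed.

Lemma oadd_ltl a : {mono oadd a : b c / b < c}.
Proof.
apply: leW_mono; apply: le_mono => b c bc.
by have [_ + _] := oadd_spec a c; apply.
Qed.

Lemma oadd_lel a : {mono oadd a : b c / b <= c}.
Proof. by move=> b c; rewrite !leNgt oadd_ltl. Qed.

Lemma oadd_inj a : injective (oadd a).
Proof.
move=> b c bc; apply: le_anti.
by rewrite -(oadd_lel a) bc lexx -(oadd_lel a) bc lexx.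
Qed.

Lemma oadd_min a b c :
  a <= c -> (forall b', b' < b -> oadd a b' < c) -> oadd a b <= c.
Proof. by have [_ _] := oadd_spec a b; apply. Qed.

Lemma olt0 a : (a < ozero) = false.
Proof. by apply/negbTE; rewrite -leNgt ozero_le. Qed.

Lemma oadd0 a : oadd a ozero = a.
Proof.
apply/le_anti; rewrite ole_add andbT; apply: oadd_min => // b.
by rewrite olt0.
Qed.

Lemma oaddS a b : oadd a (osucc b) = osucc (oadd a b).
Proof.
apply/le_anti/andP; split; last by rewrite osucc_le oadd_ltl lt_osucc.
apply: oadd_min => [|b']; first by rewrite ltW// lt_osuccE ole_add.
by rewrite !lt_osuccE oadd_lel.
Qed.

Lemma oadd_lim a b c : olimit b ->
  (oadd a b <= c) <-> (forall b', b' < b -> oadd a b' <= c).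
Proof.
move=> [/eqP b0 lb]; split=> [h b' b'b|h].
  by apply: le_trans h; rewrite oadd_lel ltW.
apply: oadd_min => [|b' /lb/h].
  by rewrite -[a]oadd0; apply: h; rewrite lt_neqAle eq_sym b0 ozero_le.
by rewrite oaddS osucc_le.
Qed.

Lemma oadd0l b : oadd ozero b = b.
Proof.
elim/ord_ind: b => b IH; apply/le_anti/andP; split.
  by apply: oadd_min => [|b' b'b]; [exact: ozero_le|rewrite IH].
rewrite leNgt; apply/negP => h; have := h.
by rewrite -(oadd_ltl ozero) IH// ltxx.
Qed.

Lemma oaddA a b c : oadd a (oadd b c) = oadd (oadd a b) c.
Proof.
elim/ord_ind: c => c IH; apply/le_anti/andP; split.
  apply: oadd_min => [|y ylt].
    exact: le_trans (ole_add _ _) (ole_add _ _).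
  rewrite ltNge; apply/negP => h.
  have by_ : b <= y.
    rewrite -(oadd_lel a); exact: le_trans (ole_add _ _) h.
  have : oadd b c <= y.
    apply: oadd_min => // c' c'c; rewrite -(oadd_ltl a) IH//.
    by apply: lt_le_trans h; rewrite oadd_ltl.
  by rewrite leNgt ylt.
apply: oadd_min => [|c' c'c]; first by rewrite oadd_lel ole_add.
by rewrite -IH// !oadd_ltl.
Qed.

(** The ordinal product [a * n]. *)
Definition omuln (a : Ord) (n : nat) : Ord := iter n (fun c => oadd c a) ozero.

Lemma omulnS a n : omuln a n.+1 = oadd (omuln a n) a. Proof. by []. Qed.

Lemma omuln1 a : omuln a 1 = a. Proof. exact: oadd0l. Qed.

Lemma omulnSl a n : omuln a n.+1 = oadd a (omuln a n).
Proof.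
elim: n => [|n IH]; first by rewrite omuln1 [omuln a 0]/= oadd0.
by rewrite omulnS {1}IH -oaddA.
Qed.

Lemma omulnD a m n : omuln a (m + n) = oadd (omuln a m) (omuln a n).
Proof.
elim: n => [|n IH]; first by rewrite addn0 [omuln a 0]/= oadd0.
by rewrite addnS !omulnS IH oaddA.
Qed.

(** [opow a] is the ordinal power omega ^ a, the least positive ordinal strictly
    above [omuln (opow b) n] for all [b < a] and all [n]. *)
Definition opow : Ord -> Ord :=
  ord_rec (fun a rec => oleast [set c | ozero < c /\
    forall b (lt_a : b < a) n, omuln (rec b lt_a) n < c]).

Lemma opow_spec a :
  [/\ ozero < opow a, forall b n, b < a -> omuln (opow b) n < opow a
    & forall c, ozero < c -> (forall b n, b < a -> omuln (opow b) n < c) ->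
      opow a <= c].
Proof.
set Q := [set c | ozero < c /\
    forall b (lt_a : b < a) n, omuln (opow b) n < c].
have EQ : opow a = oleast Q by rewrite {1}/opow ord_recE.
have bd b : exists c, forall n, omuln (opow b) n < c.
  exact: (Ord_bounded (fun n => omuln (opow b) n)).
have [F FP] := choice bd.
have [c cP] := Ord_seg_bounded F a.
have [] := @oleastP Q (Order.max (osucc ozero) c).
  split=> [|b /cP]; first by rewrite lt_max lt_osucc.
  by move=> h n; rewrite lt_max (lt_trans (FP _ _) h) orbT.
move=> [h1 h2] h3; rewrite EQ; split=> //; first by move=> b n ba; apply: h2.
by move=> d ad db; apply: h3; split=> // b ba n; exact: db.
Qed.

Lemma opow_gt0 a : ozero < opow a. Proof. by have [] := opow_spec a. Qed.

Lemma omuln_lt a m n : ozero < a -> (m < n)%N -> omuln a m < omuln a n.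
Proof.
move=> a0 mn; rewrite -(subnKC mn) addSn -addnS omulnD.
by rewrite -[X in X < _]oadd0 oadd_ltl omulnSl (lt_le_trans a0)// ole_add.
Qed.

Lemma omuln_opow a b n : b < a -> omuln (opow b) n < opow a.
Proof. by move=> ba; have [_ + _] := opow_spec a; apply. Qed.

Lemma opow_min a c : ozero < c -> (forall b n, b < a -> omuln (opow b) n < c) ->
  opow a <= c.
Proof. by have [_ _] := opow_spec a; apply. Qed.

Lemma opow_lt a b : a < b -> opow a < opow b.
Proof. by move/(omuln_opow 1); rewrite omuln1. Qed.

Lemma opow_le a b : a <= b -> opow a <= opow b.
Proof. by rewrite le_eqVlt => /predU1P[->//|/opow_lt/ltW]. Qed.

Lemma opow0 : opow ozero = osucc ozero.
Proof.
apply/le_anti; rewrite osucc_le opow_gt0 andbT; apply: opow_min => [|b n].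
  exact: lt_osucc.
by rewrite olt0.
Qed.

(** omega ^ (a + 1) is the supremum of the omega ^ a * n. *)
Lemma opowS a c : (opow (osucc a) <= c) <-> (forall n, omuln (opow a) n <= c).
Proof.
split=> [h n|h].
  by apply/ltW/lt_le_trans/h/omuln_opow/lt_osucc.
apply: opow_min => [|b n].
  by apply: lt_le_trans (h 1); rewrite omuln1 opow_gt0.
rewrite lt_osuccE le_eqVlt => /predU1P[->|ba].
  by apply: lt_le_trans (h n.+1); rewrite omuln_lt// opow_gt0.
apply: lt_le_trans (h 1); rewrite omuln1; exact: omuln_opow.
Qed.

(** omega ^ a is the supremum of the omega ^ b, b < a, when a is a limit. *)
Lemma opow_lim a c : olimit a ->
  (opow a <= c) <-> (forall b, b < a -> opow b <= c).
Proof.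
move=> [/eqP a0 la]; split=> [h b /opow_lt/ltW/le_trans|h]; first exact.
apply: opow_min => [|b n /la/h].
  apply: (lt_le_trans (opow_gt0 ozero)); apply: h.
  by rewrite lt_neqAle eq_sym a0 ozero_le.
by apply: lt_le_trans; apply/omuln_opow/lt_osucc.
Qed.

Arguments omuln : simpl never.

Section Sequences.
Variable T : Type.
Implicit Types (s t : seq T) (S : set (seq T)).

Definition initseg s t : Prop := exists u, t = s ++ u.

Definition pinitseg s t : Prop := initseg s t /\ s <> t.

Definition MAX S : set (seq T) :=
  [set s | S s /\ forall t, S t -> initseg s t -> t = s].

Definition PiS S : set (seq T * seq T) :=
  [set p | [/\ S p.1, initseg p.1 p.2 & MAX S p.2]].

(** All initial segments of [t], each listed once. *)
Definition initsegs t : seq (seq T) := [seq take k t | k <- iota 0 (size t).+1].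

End Sequences.

Definition oshift (a : Ord) (s : seq Ord) : seq Ord := [seq oadd a x | x <- s].

(** [layers w G n] is [Gamma_{xi,n}] when [w] is omega ^ xi and [G] is
    [Gamma_xi]; the index [n = 0] is not used. *)
Fixpoint layers (w : Ord) (G : set (seq Ord)) (n : nat) : set (seq Ord) :=
  match n with
  | 0 => set0
  | 1 => G
  | m.+1 => (oshift (omuln w m) @` G) `|`
      [set v | exists t u, [/\ MAX (oshift (omuln w m) @` G) t,
                               layers w G m u & v = t ++ u]]
  end.

Definition Gamma : Ord -> set (seq Ord) :=
  ord_rec (fun xi rec => [set s |
    [\/ xi = ozero /\ s = [:: ozero],
        exists z (lt_z : z < xi), xi = osucc z /\
          exists2 n, (0 < n)%N & layers (opow z) (rec z lt_z) n s
      | olimit xi /\ exists z (lt_z : osucc z < xi),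
          (oshift (opow z) @` rec (osucc z) lt_z) s]]).

Definition GammaN (xi : Ord) (n : nat) : set (seq Ord) :=
  layers (opow xi) (Gamma xi) n.

Lemma olimit0 : ~ olimit ozero. Proof. by case. Qed.

Lemma olimitS a : ~ olimit (osucc a).
Proof. by case=> _ /(_ a (lt_osucc a)); rewrite ltxx. Qed.

Lemma osucc_neq0 a : osucc a <> ozero.
Proof. by move=> a0; have := lt_osucc a; rewrite a0 olt0. Qed.

Lemma Gamma0 : Gamma ozero = [set [:: ozero]].
Proof.
rewrite /Gamma ord_recE -/Gamma; apply/seteqP; split=> s /=.
  case=> [[]//|[z [lt_z]]|[/olimit0//]].
  by exfalso; rewrite olt0 in lt_z.
by move=> ->; constructor 1.
Qed.

Lemma GammaS xi : Gamma (osucc xi) = \bigcup_(n in [set n | (0 < n)%N]) GammaN xi n.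
Proof.
rewrite {1}/Gamma ord_recE -/Gamma; apply/seteqP; split=> s /=.
  case=> [[/osucc_neq0]//|[z [lt_z [/osucc_inj <- [n n0 sn]]]]|[/olimitS]//].
  by exists n.
move=> [n /= n0 sn]; constructor 2; exists xi, (lt_osucc xi); split=> //.
by exists n.
Qed.

Lemma Gamma_lim xi : olimit xi ->
  Gamma xi = \bigcup_(z in [set z | z < xi]) (oshift (opow z) @` Gamma (osucc z)).
Proof.
move=> lx; rewrite {1}/Gamma ord_recE -/Gamma; apply/seteqP; split=> s /=.
  case=> [[x0]|[z [lt_z [xz]]]|[_ [z [lt_z zs]]]].
  - by case: lx.
  - by move: lx; rewrite xz => /olimitS.
  - by exists z => //=; apply: lt_trans lt_z; exact: lt_osucc.
move=> [z /= zx zs]; constructor 3; split=> //.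
by exists z, (lx.2 z zx).
Qed.

(** [unblocks xi n [:: t_1; ...; t_m]] is
    (omega ^ xi * (n - 1) + t_1) ++ ... ++ (omega ^ xi * (n - m) + t_m). *)
Definition unblocks (xi : Ord) (n : nat) (ts : seq (seq Ord)) : seq Ord :=
  flatten [seq oshift (omuln (opow xi) (n - i.+1)) (nth [::] ts i)
          | i <- iota 0 (size ts)].

Definition is_blocks (xi : Ord) (n : nat) (t : seq Ord) (ts : seq (seq Ord)) :=
  [/\ (0 < size ts <= n)%N, t = unblocks xi n ts,
      forall i, (i < size ts)%N -> Gamma xi (nth [::] ts i)
    & forall i, (i.+1 < size ts)%N -> MAX (Gamma xi) (nth [::] ts i)].

Definition blocks (xi : Ord) (n : nat) (t : seq Ord) : seq (seq Ord) :=
  xget [::] (is_blocks xi n t).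

Lemma oshift_inj a : injective (oshift a).
Proof. exact/inj_map/oadd_inj. Qed.

Lemma oshift0 s : oshift ozero s = s.
Proof. by rewrite /oshift (eq_map oadd0l) map_id. Qed.

Lemma layersSS w G m : layers w G m.+2 = (oshift (omuln w m.+1) @` G) `|`
      [set v | exists t u, [/\ MAX (oshift (omuln w m.+1) @` G) t,
                               layers w G m.+1 u & v = t ++ u]].
Proof. by []. Qed.

Lemma layers_lt w G n s : ozero < w ->
  (forall s, G s -> all (fun x => x < w) s /\ s <> [::]) ->
  layers w G n s -> all (fun x => x < omuln w n) s /\ s <> [::].
Proof.
move=> w0 Gw; have sh m t : G t ->
    all (fun x => x < omuln w m.+1) (oshift (omuln w m) t) /\
    oshift (omuln w m) t <> [::].
  move=> /Gw[tw t0]; split; last by case: t t0 {tw}.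
  by rewrite all_map; apply: sub_all tw => x /= xw; rewrite omulnS oadd_ltl.
elim: n s => // -[_|n IH] s; first by move=> /(sh 0%N); rewrite oshift0.
rewrite layersSS => -[[t Gt <-]|]; first exact: sh.
move=> [_ [u [[[t Gt <-] _] /IH[ua _] ->]]].
have [ta t0] := sh n.+1 _ Gt; split; last by case: (oshift _ _) t0.
rewrite all_cat ta; apply: sub_all ua => x /= xn.
by apply: lt_trans xn _; apply: omuln_lt.
Qed.

Lemma opow_add a b : a < b -> oadd (opow a) (opow (osucc a)) <= opow b.
Proof.
move=> ab; apply: (@le_trans _ _ (opow (osucc a))); last first.
  by apply: opow_le; rewrite osucc_le.
apply: oadd_min => [|c]; first by apply/opow_le/ltW/lt_osucc.
rewrite ltNge => /negP cw; rewrite ltNge; apply/negP => le_c; apply: cw.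
apply/opowS => n; rewrite -(oadd_lel (opow a)) -omulnSl.
by apply: le_trans le_c; apply/ltW/omuln_opow/lt_osucc.
Qed.

Lemma Gamma_lt xi s : Gamma xi s -> all (fun x => x < opow xi) s /\ s <> [::].
Proof.
elim/ord_ind: xi s => xi IH s.
have [->|[z xz]|lx] := Ord_cases xi.
- by rewrite Gamma0 => ->; rewrite /= opow_gt0.
- rewrite xz GammaS => -[n _ /layers_lt[||sa s0]]; first exact: opow_gt0.
    by apply: IH; rewrite xz lt_osucc.
  split=> //; apply: sub_all sa => x /= /lt_trans; apply.
  exact/omuln_opow/lt_osucc.
- rewrite Gamma_lim// => -[z /= zx [t Gt <-]].
  have [ta t0] := IH _ (lx.2 z zx) _ Gt.
  split; last by case: t t0 {Gt ta}.
  rewrite all_map; apply: sub_all ta => x /= xz.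
  by apply: lt_le_trans (opow_add zx); rewrite oadd_ltl.
Qed.

Lemma GammaN_lt xi n s :
  GammaN xi n s -> all (fun x => x < omuln (opow xi) n) s /\ s <> [::].
Proof. apply: layers_lt; [exact: opow_gt0|exact: Gamma_lt]. Qed.

Lemma unblocks_cons xi n t ts : unblocks xi n.+1 (t :: ts) =
  oshift (omuln (opow xi) n) t ++ unblocks xi n ts.
Proof.
rewrite /unblocks /= subSS subn0; congr (_ ++ flatten _).
by rewrite -[1%N]addn0 iotaDl -map_comp; apply: eq_map => i /=; rewrite subSS.
Qed.

Lemma unblocks_lt xi n ts : (size ts <= n)%N ->
  (forall i, (i < size ts)%N -> Gamma xi (nth [::] ts i)) ->
  all (fun x => x < omuln (opow xi) n) (unblocks xi n ts).
Proof.
elim: n ts => [|n IH] [|t ts]//= tsn Gts.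
rewrite unblocks_cons all_cat all_map; apply/andP; split.
  have /= [ta _] := Gamma_lt (Gts 0%N isT).
  by apply: sub_all ta => x /= xw; rewrite omulnS oadd_ltl.
have := IH ts tsn (fun i => Gts i.+1); apply: sub_all => x /lt_trans; apply.
by apply: omuln_lt => //; exact: opow_gt0.
Qed.

Lemma unblocks_inj xi n ts ts' : (size ts <= n)%N -> (size ts' <= n)%N ->
  (forall i, (i < size ts)%N -> Gamma xi (nth [::] ts i)) ->
  (forall i, (i < size ts')%N -> Gamma xi (nth [::] ts' i)) ->
  unblocks xi n ts = unblocks xi n ts' -> ts = ts'.
Proof.
elim: n ts ts' => [|n IH] [|t ts] [|t' ts']//= tsn tsn' G G'.
- have /= [_] := Gamma_lt (G' 0%N isT).
  by rewrite unblocks_cons; case: t' {G'}.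
- have /= [_] := Gamma_lt (G 0%N isT).
  by rewrite unblocks_cons; case: t {G}.
rewrite !unblocks_cons => eq_t.
have filt u us : (size us <= n)%N ->
    (forall i, (i < size us)%N -> Gamma xi (nth [::] us i)) ->
    [seq x <- oshift (omuln (opow xi) n) u ++ unblocks xi n us
    | omuln (opow xi) n <= x] = oshift (omuln (opow xi) n) u.
  move=> usn Gus; rewrite filter_cat -[RHS]cats0; congr (_ ++ _).
    by apply/all_filterP; rewrite all_map; apply/allP => x _ /=; exact: ole_add.
  apply/eqP; rewrite -[_ == _]negbK -has_filter -all_predC.
  by apply: sub_all (unblocks_lt usn Gus) => x /=; rewrite ltNge.
have tt' : t = t'.
  apply: (@oshift_inj (omuln (opow xi) n)).
  rewrite -(filt t ts)//; last by move=> i; exact: (G i.+1).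
  by rewrite eq_t filt// => i; exact: (G' i.+1).
rewrite -tt' in eq_t *; congr (_ :: _); apply: IH => //.
- by move=> i; exact: (G i.+1).
- by move=> i; exact: (G' i.+1).
by move/eqP: eq_t; rewrite eqseq_cat// eqxx => /eqP.
Qed.

Lemma is_blocks_uniq xi n t ts ts' :
  is_blocks xi n t ts -> is_blocks xi n t ts' -> ts = ts'.
Proof.
move=> [/andP[_ tsn] -> G _] [/andP[_ tsn'] eq_t G' _].
exact: unblocks_inj eq_t.
Qed.

Lemma MAX_oshift a G t : MAX (oshift a @` G) t ->
  exists2 t0, MAX G t0 & t = oshift a t0.
Proof.
move=> [[t0 Gt0 <-] mt]; exists t0 => //; split=> // u Gu [v uv].
apply: (@oshift_inj a); apply: mt; first by exists u.
by exists (oshift a v); rewrite uv /oshift map_cat.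
Qed.

Lemma is_blocks_ex xi n t : GammaN xi n t -> exists ts, is_blocks xi n t ts.
Proof.
have one m s : Gamma xi s ->
    is_blocks xi m.+1 (oshift (omuln (opow xi) m) s) [:: s].
  move=> Gs; split=> [||[]|]//; first by rewrite unblocks_cons /unblocks /= cats0.
elim: n t => // -[_ t Gt|n IH t].
  by exists [:: t]; have := one 0%N t Gt; rewrite oshift0.
rewrite /GammaN layersSS -/(GammaN xi n.+1) => -[[s Gs <-]|].
  by exists [:: s]; exact: one.
move=> [_ [u [/MAX_oshift[s Ms ->] /IH[ts [tsn -> G M]] ->]]].
exists (s :: ts); split=> [||[_|i /G//]|[_|i /M//]]; last exact: Ms.
- by have /andP[] := tsn.
- by rewrite [RHS]unblocks_cons.
- by case: Ms.
Qed.

Lemma blocksP xi n t : GammaN xi n t -> is_blocks xi n t (blocks xi n t).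
Proof. by move=> /is_blocks_ex/(xgetPex [::]). Qed.

Section Omega.
Variable D : Type.
Implicit Types (s t : seq (Ord * D)).

(** The set written [S D]: sequences of pairs whose sequence of first
    coordinates belongs to [S]. *)
Definition decorate (S : set (seq Ord)) : set (seq (Ord * D)) :=
  [set t | S (unzip1 t)].

Definition Omega (xi : Ord) : set (seq (Ord * D)) := decorate (Gamma xi).

Definition OmegaN (xi : Ord) (n : nat) : set (seq (Ord * D)) :=
  decorate (GammaN xi n).

Definition Lambda (xi : Ord) (n m : nat) : set (seq (Ord * D)) :=
  [set t | OmegaN xi n t /\
    exists2 ts, is_blocks xi n (unzip1 t) ts & size ts = m].

(** The map [iota_{xi,n}]: the last block of [t], with its decoration. *)
Definition last_block (xi : Ord) (n : nat) t : seq (Ord * D) :=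
  let tm := last [::] (blocks xi n (unzip1 t)) in
  zip tm (drop (size t - size tm) (unzip2 t)).

Definition is_unit (xi : Ord) (n : nat) (V : set (seq (Ord * D))) : Prop :=
  V = Lambda xi n 1 \/
  exists m s, [/\ (1 <= m < n)%N, MAX (Lambda xi n m) s
                & V = [set t | pinitseg s t /\ Lambda xi n m.+1 t]].

Definition same_level (xi : Ord) (n : nat) s t : Prop :=
  exists m, Lambda xi n m s /\ Lambda xi n m t.

Definition oshiftD (a : Ord) t : seq (Ord * D) := [seq (oadd a x.1, x.2) | x <- t].

Variable leD : D -> D -> Prop.

Definition directed_set : Prop :=
  [/\ inhabited D, forall x, leD x x,
      forall x y z, leD x y -> leD y z -> leD x z
    & forall x y, exists z, leD x z /\ leD y z].

Definition pruning (A B : set (seq (Ord * D)))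
    (theta : seq (Ord * D) -> seq (Ord * D)) : Prop :=
  [/\ forall s, A s -> B (theta s),
      forall s t, A s -> A t -> pinitseg s t -> pinitseg (theta s) (theta t)
    & forall s, A s -> forall s0 z U s1 z' U', s = rcons s0 (z, U) ->
        theta s = rcons s1 (z', U') -> leD U U'].

Definition extended_pruning (A B : set (seq (Ord * D)))
    (theta e : seq (Ord * D) -> seq (Ord * D)) : Prop :=
  [/\ pruning A B theta, forall t, MAX A t -> MAX B (e t)
    & forall t, MAX A t -> initseg (theta t) (e t)].

Definition unit_preserving (xi : Ord) (n : nat)
    (theta e : seq (Ord * D) -> seq (Ord * D)) : Prop :=
  [/\ extended_pruning (OmegaN xi n) (OmegaN xi n) theta e,
      forall V, is_unit xi n V -> exists2 W, is_unit xi n W & theta @` V `<=` W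
    & forall s t, OmegaN xi n s -> OmegaN xi n t -> pinitseg s t ->
        ~ same_level xi n s t -> ~ same_level xi n (theta s) (theta t)].

End Omega.

Section Prob.
Local Open Scope ring_scope.
Variables (R : realType) (D : Type).
Implicit Types (t : seq (Ord * D)) (p : R).

Inductive prob_graph : Ord -> seq (Ord * D) -> R -> Prop :=
| prob_graph0 U : prob_graph ozero [:: (ozero, U)] 1
| prob_graphS xi n t p : (0 < n)%N -> OmegaN xi n t ->
    prob_graph xi (last_block xi n t) p ->
    prob_graph (osucc xi) t (n%:R^-1 * p)
| prob_graph_lim xi z t p : olimit xi -> (z < xi)%O -> Omega (osucc z) t ->
    prob_graph (osucc z) t p -> prob_graph xi (oshiftD (opow z) t) p.

(** The map [P_xi], extended by [0] outside [Omega xi]. *)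
Definition prob (xi : Ord) t : R := xget 0 [set p | prob_graph xi t p].


Lemma head_in (T : Type) (a : pred T) (x0 : T) (s : seq T) :
  s <> [::] -> all a s -> a (head x0 s).
Proof. by case: s => //= x s _ /andP[]. Qed.

Lemma GammaN_head xi n s : GammaN xi n.+1 s ->
  (omuln (opow xi) n <= head ozero s < omuln (opow xi) n.+1)%O.
Proof.
move=> Gs; have [sa s0] := GammaN_lt Gs; apply/andP; split; last first.
  exact: (head_in (a := fun x => (x < omuln (opow xi) n.+1)%O)) sa.
case: n Gs {sa s0} => [_|n]; first exact: ozero_le.
rewrite /GammaN layersSS => -[[t /Gamma_lt[_ t0] <-]|].
  by case: t t0 => //= x t _; exact: ole_add.
move=> [_ [u [/MAX_oshift[t [/Gamma_lt[_ t0] _] ->] _ ->]]].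
by case: t t0 => //= x t _; exact: ole_add.
Qed.

Lemma GammaN_disj xi m n s : (0 < m)%N -> (0 < n)%N ->
  GammaN xi m s -> GammaN xi n s -> m = n.
Proof.
case: m n => // m [//|n] _ _ /GammaN_head/andP[m1 m2] /GammaN_head/andP[n1 n2].
have mono i j : (omuln (opow xi) i < omuln (opow xi) j)%O -> (i < j)%N.
  move=> ij; rewrite ltnNge leq_eqVlt; apply/negP => /predU1P[ji|ji].
    by rewrite ji ltxx in ij.
  by have := lt_trans ij (omuln_lt (opow_gt0 xi) ji); rewrite ltxx.
by apply/eqP; rewrite eqn_leq (mono _ _ (le_lt_trans m1 n2)) mono// (le_lt_trans n1 m2).
Qed.

Lemma Gamma_lim_disj z z' s s' : Gamma (osucc z) s -> Gamma (osucc z') s' ->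
  oshift (opow z) s = oshift (opow z') s' -> z = z' /\ s = s'.
Proof.
have lt_head y y' u u' : Gamma (osucc y) u -> Gamma (osucc y') u' ->
    oshift (opow y) u = oshift (opow y') u' -> ~ (y < y')%O.
  move=> /Gamma_lt[+ +] /Gamma_lt[_ +].
  case: u u' => [//|x u] [//|x' u'] /= /andP[xy _] _ _ [xx' _] /opow_add.
  rewrite leNgt => /negP; apply; apply: (@le_lt_trans _ _ (oadd (opow y) x)).
    by rewrite xx' ole_add.
  by rewrite oadd_ltl.
move=> Gs Gs' eq_s; have zz' : z = z'.
  case: (ltgtP z z') => // h; exfalso.
    exact: lt_head Gs Gs' eq_s h.
  exact: lt_head Gs' Gs (esym eq_s) h.
by split=> //; move: eq_s; rewrite zz' => /oshift_inj.
Qed.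

Lemma unzip1_oshiftD a t : unzip1 (oshiftD a t) = oshift a (unzip1 t).
Proof. by rewrite /oshiftD /oshift /unzip1 -!map_comp. Qed.

Lemma oshiftD_inj a : injective (@oshiftD D a).
Proof.
apply: inj_map => -[x U] [y V] /= [/oadd_inj -> ->].
by [].
Qed.

Lemma last_blockP xi n t : OmegaN xi n t -> Omega xi (last_block xi n t).
Proof.
rewrite /OmegaN /decorate /= => /blocksP[/andP[b0 _] eq_t Gb _].
rewrite /Omega /decorate /last_block /=.
set bs := blocks _ _ _ in b0 eq_t Gb *.
have Gl : Gamma xi (last [::] bs) by rewrite -nth_last; apply: Gb; rewrite prednK.
have szt : (size (last [::] bs) <= size t)%N.
  rewrite -(size_map fst t) -/(unzip1 t) eq_t /unblocks.
  elim/last_ind: (bs) b0 => // us u _ _; rewrite last_rcons size_rcons.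
  rewrite -addn1 iotaD map_cat flatten_cat size_cat /= cats0 size_map.
  by rewrite add0n nth_rcons ltnn eqxx leq_addl.
by rewrite /unzip1 -/(unzip1 _) unzip1_zip// size_drop size_map subKn.
Qed.

Lemma prob_graph_fun xi t p q : prob_graph xi t p -> prob_graph xi t q -> p = q.
Proof.
have inv y u r : prob_graph y u r -> [\/ y = ozero /\ r = 1,
    exists z n r0, [/\ y = osucc z, (0 < n)%N, OmegaN z n u,
      prob_graph z (last_block z n u) r0 & r = n%:R^-1 * r0]
  | olimit y /\ exists z u0, [/\ Omega (osucc z) u0,
      prob_graph (osucc z) u0 r & u = oshiftD (opow z) u0]].
  case=> [U|z n v r0 n0 nv gr|z z' v r0 lz zz' Ov gr].
  - by constructor 1.
  - by constructor 2; exists z, n, r0.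
  - by constructor 3; split=> //; exists z', v.
move=> gp; elim: gp q => {xi t p} [U|xi n t p n0 nt _ IH|xi z t p lx zx Ot _ IH] q /inv.
- case=> [[_ ->]//|[z [n [r0 [/esym/osucc_neq0//]]]]|[/olimit0//]].
- case=> [[/osucc_neq0//]|[z [m [r0 [/osucc_inj <- m0 mt gr ->]]]]|[/olimitS//]].
  have nm : n = m by exact: GammaN_disj nt mt.
  by rewrite -nm in gr *; rewrite (IH _ gr).
- case=> [[x0]|[z' [m [r0 [xz]]]]|[_ [z' [u [Ou gr eq_t]]]]].
  + by case: lx.
  + by move: lx; rewrite xz => /olimitS.
  have [zz' _] : z = z' /\ unzip1 t = unzip1 u.
    by apply: Gamma_lim_disj => //; rewrite -!unzip1_oshiftD eq_t.
  by move: eq_t gr; rewrite -zz' => /oshiftD_inj <- /IH.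
Qed.

Lemma prob_graph_ex xi t : Omega xi t -> exists p, prob_graph xi t p.
Proof.
elim/ord_ind: xi t => xi IH t.
have [->|[z xz]|lx] := Ord_cases xi.
- rewrite /Omega Gamma0; case: t => [//|[x U] [|//]] /= [->].
  by exists 1; constructor.
- rewrite xz /Omega GammaS => -[n /= n0 nt].
  have [|p gp] := IH z _ _ (last_blockP nt); first by rewrite xz lt_osucc.
  by exists (n%:R^-1 * p); constructor.
- rewrite /Omega Gamma_lim// => -[z /= zx [s Gs st]].
  pose u := zip s (unzip2 t).
  have su : size s = size t.
    by rewrite -(size_map (oadd (opow z)) s) -/(oshift _ _) st size_map.
  have us : unzip1 u = s by rewrite unzip1_zip// size_map su.
  have tu : t = oshiftD (opow z) u.
    rewrite -[LHS]zip_unzip -[RHS]zip_unzip unzip1_oshiftD us st.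
    congr zip; rewrite /oshiftD /unzip2 -map_comp.
    by rewrite [RHS](_ : _ = unzip2 u)// unzip2_zip// size_map su.
  have Ou : Omega (osucc z) u by rewrite /Omega /decorate /= us.
  have [p gp] := IH _ (lx.2 z zx) _ Ou.
  by exists p; rewrite tu; constructor.
Qed.

Lemma prob_eq xi t p : prob_graph xi t p -> prob xi t = p.
Proof.
move=> gp; apply: (xget_unique _ gp) => q gq.
exact: prob_graph_fun gq gp.
Qed.

Lemma probP xi t : Omega xi t -> prob_graph xi t (prob xi t).
Proof. by move=> /prob_graph_ex[p gp]; rewrite (prob_eq gp). Qed.

Lemma prob0 U : prob ozero [:: (ozero, U)] = 1.
Proof. by apply/prob_eq; constructor. Qed.

Lemma probS xi n t : (0 < n)%N -> OmegaN xi n t ->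
  prob (osucc xi) t = n%:R^-1 * prob xi (last_block xi n t).
Proof.
by move=> n0 nt; apply/prob_eq; constructor=> //; exact/probP/last_blockP.
Qed.

Lemma prob_lim xi z t : olimit xi -> (z < xi)%O -> Omega (osucc z) t ->
  prob xi (oshiftD (opow z) t) = prob (osucc z) t.
Proof. by move=> lx zx Ot; apply/prob_eq; constructor=> //; exact: probP. Qed.

End Prob.

Arguments prob {R D} xi t.

(* Main.v *)
Require Import Defs.
From mathcomp Require Import all_boot all_order all_algebra.
From mathcomp Require Import all_classical all_reals.
From mathcomp Require Import lra.
Import Order.TTheory GRing.Theory Num.Theory.
Set Implicit Arguments.
Unset Strict Implicit.
Unset Printing Implicit Defensive.
Local Open Scope classical_set_scope.
Local Open Scope ring_scope.

(** The heart of the matter is the case [n = 1], proved by induction on [xi]; the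
    general case follows by induction on [n].

    For a fixed [n], apply the induction hypothesis to the part of the tree above
    each maximal node [t] of the first level, and prune that part further so that
    the values [f s t'] for the finitely many [s] below [t] hardly depend on the
    extension [t'] of [t].  This turns [f] into a function on the first level
    alone, to which the case [n = 1] applies; a last pruning of the first level
    makes the numbers [a_i] chosen above [t] almost independent of [t].  Pruning
    to make a function of the maximal nodes almost constant is itself an instance
    of the theorem, for an [f] that ignores its first argument, because the
    weights along a branch add up to [1].

    For [osucc xi], apply the theorem to [OmegaN xi N] for all [N].  The means of
    the numbers [a_i] cluster at some [a] for infinitely many [N], and when [N] is
    large at least [n] of the levels satisfy [a_i >= a - delta / 2]; [OmegaN xi n]
    embeds into these levels.  Limits are treated by the same clustering argument
    along the cofinal set of smaller ordinals, and [xi = 0] by clustering along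
    the directed set [D]. *)

(** * Initial segments and maximal members of sets of sequences *)

Section InitialSegments.
Variable T : Type.
Implicit Types (s t u : seq T) (S : set (seq T)).

Lemma initseg_refl s : initseg s s.
Proof. by exists [::]; rewrite cats0. Qed.

Lemma initseg_trans s t u : initseg s t -> initseg t u -> initseg s u.
Proof. by move=> [v ->] [w ->]; exists (v ++ w); rewrite catA. Qed.

Lemma initseg_cat s u : initseg s (s ++ u).
Proof. by exists u. Qed.

Lemma initseg_take k t : initseg (take k t) t.
Proof. by exists (drop k t); rewrite cat_take_drop. Qed.

Lemma initseg_size s t : initseg s t -> (size s <= size t)%N.
Proof. by move=> [u ->]; rewrite size_cat leq_addr. Qed.

Lemma initseg_anti s t : initseg s t -> initseg t s -> s = t.
Proof.
move=> [u ->] /initseg_size; rewrite size_cat -[X in (_ <= X)%N]addn0 leq_add2l.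
by case: u => //; rewrite cats0.
Qed.

Lemma initseg_pinitseg_trans s t u : initseg s t -> pinitseg t u -> pinitseg s u.
Proof.
move=> st [tu tNu]; split; first exact: initseg_trans tu.
by move=> su; apply: tNu; apply: initseg_anti => //; rewrite -su.
Qed.

Lemma initseg_catl w s t : initseg (w ++ s) (w ++ t) <-> initseg s t.
Proof.
split=> -[u]; last by move=> ->; exists u; rewrite catA.
rewrite -catA => /(congr1 (drop (size w))); rewrite !drop_size_cat// => ->.
by exists u.
Qed.

Lemma pinitseg_cat s u : u <> [::] -> pinitseg s (s ++ u).
Proof.
move=> u0; split; first exact: initseg_cat.
move=> /(congr1 (drop (size s))); rewrite drop_size drop_size_cat//.
by move=> u0'; apply: u0.
Qed.

Lemma pinitseg_catl w s t : pinitseg s t -> pinitseg (w ++ s) (w ++ t).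
Proof.
move=> [st sNt]; split; first exact/initseg_catl.
by move=> /(congr1 (drop (size w))); rewrite !drop_size_cat.
Qed.

Lemma initseg_filter (a : pred T) s t :
  initseg s t -> initseg [seq x <- s | a x] [seq x <- t | a x].
Proof. by move=> [u ->]; rewrite filter_cat; exact: initseg_cat. Qed.

Lemma initseg_all (a : pred T) s t : initseg s t -> all a t -> all a s.
Proof. by move=> [u ->]; rewrite all_cat => /andP[]. Qed.

Lemma initseg_nil s : initseg s [::] -> s = [::].
Proof. by move=> /initseg_size; case: s. Qed.

Lemma initseg_takeE s t : initseg s t -> s = take (size s) t.
Proof. by move=> [u ->]; rewrite take_size_cat. Qed.

Lemma initseg_comparable s t u : initseg s u -> initseg t u ->
  initseg s t \/ initseg t s.
Proof.
move=> /initseg_takeE -> /initseg_takeE ->.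
case/orP: (leq_total (size s) (size t)) => st; [left|right].
  by rewrite -(take_takel _ st); exact: initseg_take.
by rewrite -(take_takel _ st); exact: initseg_take.
Qed.

Lemma MAX_in S t : MAX S t -> S t. Proof. by case. Qed.

Lemma MAX_initseg S s t : MAX S s -> S t -> initseg s t -> s = t.
Proof. by move=> [_ m] St st; rewrite (m t St st). Qed.

End InitialSegments.

Lemma initseg_map (T T' : Type) (g : T -> T') (s t : seq T) :
  initseg s t -> initseg (map g s) (map g t).
Proof. by move=> [u ->]; rewrite map_cat; exact: initseg_cat. Qed.

(** * Sums along a branch *)

Definition isum (R : realType) (T : Type) (Q : seq T -> Prop) (G : seq T -> R)
    (t : seq T) : R :=
  \sum_(s <- initsegs t | `[< Q s >]) G s.

Section BranchSums.
Variables (R : realType) (T : Type).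
Implicit Types (Q : seq T -> Prop) (G : seq T -> R) (s t u : seq T).

Lemma eq_isum Q Q' G G' t :
  (forall s, initseg s t -> Q s <-> Q' s) ->
  (forall s, initseg s t -> Q s -> G s = G' s) -> isum Q G t = isum Q' G' t.
Proof.
move=> QQ GG; rewrite /isum /initsegs !big_map.
have it k := @initseg_take T k t.
rewrite (eq_bigl (fun k => `[< Q' (take k t) >])) => [|k]; last first.
  by apply/asboolP/asboolP => /QQ; apply.
by apply: eq_bigr => k /asboolP h; apply: GG => //; exact/QQ.
Qed.

Lemma ler_isum Q G G' t :
  (forall s, initseg s t -> Q s -> G s <= G' s) -> isum Q G t <= isum Q G' t.
Proof.
move=> GG; rewrite /isum /initsegs !big_map; apply: ler_sum => k /asboolP h.
exact/GG/h/initseg_take.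
Qed.

Lemma isum_mull Q (c : R) G t : isum Q (fun s => c * G s) t = c * isum Q G t.
Proof. by rewrite /isum mulr_sumr. Qed.

Lemma isum_mulr Q (c : R) G t : isum Q (fun s => G s * c) t = isum Q G t * c.
Proof. by rewrite /isum mulr_suml. Qed.

Lemma isumD Q G G' t : isum Q (fun s => G s + G' s) t = isum Q G t + isum Q G' t.
Proof. by rewrite /isum big_split. Qed.

Lemma isum0 Q G t : (forall s, initseg s t -> ~ Q s) -> isum Q G t = 0.
Proof.
move=> nQ; rewrite /isum /initsegs big_map big1// => k /asboolP h.
by exfalso; apply: (nQ _ _ h); exact: initseg_take.
Qed.

(** An initial segment of [t ++ u] either is one of [t] or ends inside [u]. The condition [v <>
    [::]] keeps [t] itself from being counted twice. *)
Lemma isum_cat Q G t u :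
  isum Q G (t ++ u) =
  isum Q G t + isum (fun v => v <> [::] /\ Q (t ++ v)) (fun v => G (t ++ v)) u.
Proof.
rewrite /isum /initsegs !big_map size_cat -addSn iotaD big_cat /=.
congr (_ + _).
  have it k : k \in iota 0 (size t).+1 -> take k (t ++ u) = take k t.
    by rewrite mem_iota add0n ltnS => /takel_cat ->.
  rewrite [LHS]big_seq_cond [RHS]big_seq_cond; apply: eq_big => [k|k /andP[/it ->]//].
  by case: (boolP (k \in _)) => //= /it ->.
(* The length 0 in [u] would list [t] a second time. *)
rewrite [RHS]big_cons take0; have -> : `[< [::] <> [::] :> seq T /\ Q (t ++ [::]) >] = false.
  by apply/asboolP => -[].
rewrite ?add0n -[(size t).+1]addn1 iotaDl big_map.
rewrite [LHS]big_seq_cond [RHS]big_seq_cond.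
have tk k : take (size t + k) (t ++ u) = t ++ take k u.
  by rewrite take_cat ltnNge leq_addr /= addKn.
apply: eq_big => [k|k _]; last by rewrite tk.
rewrite tk; case: (boolP (k \in _)) => //=; rewrite mem_iota => /andP[k0 ku].
apply/asboolP/asboolP => [q|[]//]; split=> //.
move=> /(congr1 size); rewrite size_take /=.
case: ltnP; first by move=> _ k0'; rewrite k0' in k0.
by move=> uk u0; move: ku; rewrite add1n u0 ltnS leqNgt k0.
Qed.

End BranchSums.

Lemma isum_map (R : realType) (T T' : Type) (g : T -> T')
  (Q : seq T' -> Prop) (G : seq T' -> R) (t : seq T) :
  isum Q G (map g t) = isum (fun s => Q (map g s)) (fun s => G (map g s)) t.
Proof.
rewrite /isum /initsegs !big_map size_map.
by apply: eq_big => [k|k _]; rewrite map_take.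
Qed.

(** * Cluster values of bounded functions on directed sets *)

Lemma archi_nat (R : realType) (x : R) : exists k, x <= k%:R.
Proof. by exists (Num.truncn x).+1; apply/ltW/truncnS_gt. Qed.

(** If a union of two sets is cofinal in a directed set, so is one of them. Cutting intervals of
    length [eta] off [[-1, 1]] one by one, some such interval has a cofinal preimage under [h]. *)
Lemma cofinal_cluster (R : realType) (I : Type) (le : I -> I -> Prop)
    (h : I -> R) (eta : R) :
  inhabited I -> (forall x y z, le x y -> le y z -> le x z) ->
  (forall x y, exists z, le x z /\ le y z) ->
  (forall i, -1 <= h i <= 1) -> 0 < eta ->
  exists2 a, -1 <= a <= 1 & forall i, exists j, le i j /\ `|h j - a| <= eta.
Proof.
move=> [i0] le_tr le_dir h1 eta0.
pose big (S : I -> Prop) := forall i, exists j, le i j /\ S j.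
have bigU S S' : big (fun j => S j \/ S' j) -> big S \/ big S'.
  move=> bSS'; apply: contrapT => /not_orP[/existsNP[x nx] /existsNP[y ny]].
  have [z [xz yz]] := le_dir x y; have [j [zj [Sj|Sj]]] := bSS' z.
    by apply: nx; exists j; split=> //; exact: le_tr zj.
  by apply: ny; exists j; split=> //; exact: le_tr zj.
have sub k x : big (fun j => x <= h j <= x + k%:R * eta) ->
    exists y, big (fun j => y <= h j <= y + eta).
  elim: k x => [|k IH] x bx.
    exists x => i; have [j [ij /andP[xj jx]]] := bx i; exists j; split=> //.
    by rewrite xj (le_trans jx)// mul0r addr0 lerDl ltW.
  have [|bx'|/IH//] := bigU (fun j => x <= h j <= x + eta)
      (fun j => x + eta <= h j <= x + eta + k%:R * eta).
    move=> i; have [j [ij /andP[xj jx]]] := bx i; exists j; split=> //.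
    have [le1|/ltW ge1] := leP (h j) (x + eta); first by left; rewrite xj.
    by right; rewrite ge1 (le_trans jx)//; lra.
  by exists x.
have [k kP] := archi_nat (2 / eta).
have [|y yP] := sub k (-1).
  move=> i; have [j [ij _]] := le_dir i i; exists j; split=> //.
  have /andP[-> hj] := h1 j; rewrite (le_trans hj)//=.
  by move: kP; rewrite ler_pdivrMr// => kP; lra.
(* A value of [h] in the interval, rather than its endpoint, is sure to lie in [[-1, 1]]. *)
have [j0 [_ yj0]] := yP i0; exists (h j0); first exact: h1.
move=> i; have [j [ij yj]] := yP i; exists j; split=> //.
by rewrite ler_norml; apply/andP; split; lra.
Qed.

(** * Extended prunings and the assertion for a single level *)

Section Prunings.
Variables (D : Type) (leD : D -> D -> Prop) (dirD : directed_set leD).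
Implicit Types (s t u : seq (Ord * D)) (A B C : set (seq (Ord * D))).

Definition label t : option D := last None [seq Some x.2 | x <- t].

Definition label_le s t : Prop :=
  forall U, label s = Some U -> exists2 U', label t = Some U' & leD U U'.

Lemma label_cat s t : t <> [::] -> label (s ++ t) = label t.
Proof. by case: t => // x t _; rewrite /label map_cat last_cat. Qed.

Lemma label_oshiftD c t : label (oshiftD c t) = label t.
Proof. by rewrite /label /oshiftD -map_comp. Qed.

Lemma label_le_refl s : label_le s s.
Proof. by case: dirD => _ refl _ _ U ->; exists U. Qed.

Lemma label_le_trans s t u : label_le s t -> label_le t u -> label_le s u.
Proof.
case: dirD => _ _ trans _ st tu U /st[V /tu[W ->] VW UV]; exists W => //.
exact: trans VW.
Qed.

Lemma label_le_cat w s t : t <> [::] -> label_le s t -> label_le s (w ++ t).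
Proof. by move=> t0 st U /st[V tV UV]; exists V => //; rewrite label_cat. Qed.

(** Extended prunings, with the condition on last terms phrased so as to compose. *)
Definition xprune A B (theta e : seq (Ord * D) -> seq (Ord * D)) : Prop :=
  [/\ forall s, A s -> B (theta s),
      forall s t, A s -> A t -> pinitseg s t -> pinitseg (theta s) (theta t),
      forall s, A s -> label_le s (theta s),
      forall t, MAX A t -> MAX B (e t)
    & forall t, MAX A t -> initseg (theta t) (e t)].

Lemma xprune_ext A B theta e :
  xprune A B theta e -> extended_pruning leD A B theta e.
Proof.
move=> [AB th lab eAB ethe]; split=> //; split=> // s As s0 z U s1 z' U' sE thE.
have := lab s As U; rewrite thE sE /label !map_rcons !last_rcons.
by move=> /(_ erefl)[_ [<-]].
Qed.

Lemma xprune_le A B theta e s t : xprune A B theta e -> A s -> A t ->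
  initseg s t -> initseg (theta s) (theta t).
Proof.
move=> [_ th _ _ _] As At st; have [->|sNt] := pselect (s = t).
  exact: initseg_refl.
by have [] : pinitseg (theta s) (theta t) by apply: th.
Qed.

Lemma xprune_id A : xprune A A id id.
Proof. by split=> // s _; [exact: label_le_refl|exact: initseg_refl]. Qed.

Lemma xprune_comp A B C theta e theta' e' :
  xprune B C theta e -> xprune A B theta' e' ->
  xprune A C (theta \o theta') (e \o e').
Proof.
move=> th th'; have [thBC thl lab eBC te] := th; have [thAB thl' lab' eAB te'] := th'.
split=> [s /thAB/thBC//|s t As At st|s As|t /eAB/eBC//|t Mt] /=.
- by apply: thl; [exact: thAB|exact: thAB|exact: thl'].
- exact: label_le_trans (lab' _ As) (lab _ (thAB _ As)).
- apply: initseg_trans (te _ (eAB _ Mt)); apply: (xprune_le th) (te' _ Mt).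
    by apply: thAB; exact: MAX_in.
  by apply: MAX_in; exact: eAB.
Qed.

Lemma pinitseg_oshiftD c s t : pinitseg s t -> pinitseg (oshiftD c s) (oshiftD c t).
Proof.
move=> [st sNt]; split; first exact: initseg_map.
by move/oshiftD_inj.
Qed.

Lemma initseg_oshiftD c s t :
  initseg (oshiftD c s) (oshiftD c t) <-> initseg s t.
Proof.
split; last exact: initseg_map.
move=> /initseg_takeE; rewrite size_map -map_take => /oshiftD_inj ->.
exact: initseg_take.
Qed.

Lemma xprune_oshiftD A B c : (forall s, A s -> B (oshiftD c s)) ->
  (forall s, MAX A s -> MAX B (oshiftD c s)) ->
  xprune A B (oshiftD c) (oshiftD c).
Proof.
move=> AB mAB; split=> // [s t _ _|s _|t _]; first exact: pinitseg_oshiftD.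
  by move=> U sU; rewrite label_oshiftD; exact: label_le_refl.
exact: initseg_refl.
Qed.

Lemma MAX_image_oshiftD A c s : MAX (oshiftD c @` A) (oshiftD c s) <-> MAX A s.
Proof.
split=> [[[s' As' /oshiftD_inj sE] m]|[As m]]; rewrite -?sE in m *; split=> //.
- move=> t At st; apply: (@oshiftD_inj _ c); apply: m; first by exists t.
  exact/initseg_oshiftD.
- by move=> _ [t At <-] /initseg_oshiftD/(m _ At) ->.
Qed.

(** Subtraction of [c] on the left, term by term. The choice is unique by [oadd_inj]; a term below
    [c] gets the default [ozero]. *)
Definition unshift c t : seq (Ord * D) :=
  [seq (xget ozero [set y | oadd c y = x.1], x.2) | x <- t].

Lemma oshiftDK c : cancel (@oshiftD D c) (unshift c).
Proof.
move=> t; rewrite /unshift /oshiftD -map_comp -[RHS]map_id; apply: eq_map => -[x U] /=.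
congr pair; apply: (@oadd_inj c).
by apply: (@xgetPex _ ozero [set y | oadd c y = oadd c x]); exists x.
Qed.

Lemma xprune_unshift A c : xprune (oshiftD c @` A) A (unshift c) (unshift c).
Proof.
split=> [_ [s As <-]|_ _ [s As <-] [t At <-]|_ [s As <-]|t Mt|t _].
- by rewrite oshiftDK.
- rewrite !oshiftDK => -[/initseg_oshiftD st sNt]; split=> // e.
  by apply: sNt; rewrite e.
- by rewrite oshiftDK => U; rewrite label_oshiftD; exact: label_le_refl.
- have [s As sE] := MAX_in Mt; rewrite -sE oshiftDK.
  by move: Mt; rewrite -sE => /MAX_image_oshiftD.
- exact: initseg_refl.
Qed.

Variable R : realType.
Implicit Types (p : seq (Ord * D) -> R) (f : seq (Ord * D) -> seq (Ord * D) -> R).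

(** The assertion of the theorem for a tree with a single level, with nodes [B],
    weights [p] and a map defined on a tree with nodes [A]. *)
Definition good_map A B p f (delta a : R) theta e : Prop :=
  [/\ xprune A B theta e,
      forall s t, A s -> MAX A t -> initseg s t -> a - delta <= f (theta s) (e t)
    & forall t, MAX A t -> isum B (fun s => p s * f s (e t)) (e t) <= a + delta].

Definition bounded_on A f := forall s t, PiS A (s, t) -> -1 <= f s t <= 1.

Definition good A p : Prop := forall delta f, 0 < delta -> bounded_on A f ->
  exists theta e a, good_map A A p f delta a theta e /\ -1 <= a <= 1.

(** Further pruning does no harm: the upper bound concerns the whole branch below [e t], for every
    maximal [t], and the lower bound survives because [theta' s] stays below [e' t]. *)
Lemma good_map_comp A B C p f delta a theta e theta' e' :
  good_map B C p f delta a theta e -> xprune A B theta' e' ->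
  good_map A C p f delta a (theta \o theta') (e \o e').
Proof.
move=> [th lo up] th'; have [thAB _ _ eAB te'] := th'.
split; first exact: xprune_comp th'; last by move=> t /eAB/up.
move=> s t As Mt st; apply: lo; [exact: thAB|exact: eAB|].
exact: initseg_trans (xprune_le th' As (MAX_in Mt) st) (te' _ Mt).
Qed.

(** * Unions of mutually incomparable trees *)

Section Union.
Variables (I : Type) (K : I -> set (seq (Ord * D))).
Hypothesis Kdisj : forall i j s t, K i s -> K j t -> initseg s t -> i = j.

Let U := \bigcup_i K i.

Lemma MAX_union t : MAX U t <-> exists i, MAX (K i) t.
Proof.
split=> [[[i _ Kt] m]|[i [Kt m]]].
  by exists i; split=> // u Ku; apply: m; exists i.
split; first by exists i.
by move=> u [j _ Ku] tu; apply: m => //; rewrite (Kdisj Kt Ku tu).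
Qed.

(** Nodes of different [K i] are incomparable, so the maps can be chosen independently on each
    [K i]; only the constant [a] must be common. Successor and limit [Omega] are both unions of this
    kind. *)
Lemma good_union p : (forall delta f, 0 < delta -> bounded_on U f ->
    exists2 a, -1 <= a <= 1 & forall i, exists j theta e,
      good_map (K i) (K j) p f delta a theta e) ->
  good U p.
Proof.
move=> H delta f delta0 fb.
have [a a1 /choice[j /choice[th /choice[e G]]]] := H _ _ delta0 fb.
(* [idx] finds the piece containing a node; it is unique because a node is comparable with
   itself. *)
have /choice[idx idxE] : forall t, exists o, forall i, K i t -> o = Some i.
  move=> t; have [[i Kt]|nK] := pselect (exists i, K i t).
    by exists (Some i) => k Kk; congr Some; exact: Kdisj Kt Kk (initseg_refl t).
  by exists None => i Kt; case: nK; exists i.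
exists (fun t => if idx t is Some i then th i t else t).
exists (fun t => if idx t is Some i then e i t else t), a; split=> //.
split; [split| |].
- move=> s [i _ Ks]; rewrite (idxE _ i)//; have [[thK _ _ _ _] _ _] := G i.
  by exists (j i) => //; exact: thK.
- move=> s t [i _ Ks] [k _ Kt] st; have ik := Kdisj Ks Kt st.1.
  rewrite -{k}ik in Kt; rewrite !(idxE _ i)//.
  by have [[_ + _ _ _] _ _] := G i; apply.
- move=> s [i _ Ks]; rewrite (idxE _ i)//.
  by have [[_ _ + _ _] _ _] := G i; apply.
- move=> t /MAX_union[i Mt]; rewrite (idxE _ i); last exact: MAX_in.
  by have [[_ _ _ + _] _ _] := G i => /(_ _ Mt) M; apply/MAX_union; exists (j i).
- move=> t /MAX_union[i Mt]; rewrite (idxE _ i); last exact: MAX_in.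
  by have [[_ _ _ _ +] _ _] := G i; apply.
- move=> s t [i _ Ks] /MAX_union[k Mt] st; have ik := Kdisj Ks (MAX_in Mt) st.
  rewrite -{k}ik in Mt; rewrite !(idxE _ i)//; last exact: MAX_in.
  by have [_ + _] := G i; apply.
- move=> t /MAX_union[i Mt]; rewrite (idxE _ i); last exact: MAX_in.
  have [[_ _ _ eK _] _ /(_ _ Mt)] := G i; apply: le_trans.
  (* A branch ending in [K (j i)] meets no other piece, so the sums over [U] and over [K (j i)]
     agree. *)
  rewrite le_eqVlt; apply/orP; left; apply/eqP; apply: eq_isum => // s st.
  split; last by exists (j i).
  by move=> [k _ Ks]; rewrite -(Kdisj Ks (MAX_in (eK _ Mt)) st).
Qed.

End Union.

(** The functions are treated one after the other. The property [ok] is a parameter so that the same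
    induction serves plain prunings ([True]) and prunings that respect units ([unit_map]). *)
Lemma stabilize_seq A (ok : (seq (Ord * D) -> seq (Ord * D)) -> Prop) :
  ok id ->
  (forall theta theta', (forall s, A s -> A (theta' s)) ->
    ok theta -> ok theta' -> ok (theta \o theta')) ->
  (forall (h : seq (Ord * D) -> R) eta, 0 < eta ->
    (forall t, MAX A t -> -1 <= h t <= 1) ->
    exists theta e b, [/\ xprune A A theta e, ok theta, -1 <= b <= 1
      & forall t, MAX A t -> `|h (e t) - b| <= eta]) ->
  forall (J : eqType) (l : seq J) (h : J -> seq (Ord * D) -> R) eta, 0 < eta ->
  (forall j t, j \in l -> MAX A t -> -1 <= h j t <= 1) ->
  exists theta e (b : J -> R),
    [/\ xprune A A theta e, ok theta, forall j, -1 <= b j <= 1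
      & forall j t, j \in l -> MAX A t -> `|h j (e t) - b j| <= eta].
Proof.
move=> ok1 okM one J l h eta eta0; elim: l h => [|j l IH] h h1.
  exists id, id, (fun=> 0); split=> // [|j]; first exact: xprune_id.
  by rewrite lerN10 ler01.
have [|theta [e [b [th th_ok b1 hb]]]] := IH h.
  by move=> k t kl; apply: h1; rewrite inE kl orbT.
have [thA _ _ eA te] := th.
(* The new function is read after [e], so the estimates already obtained persist for [e \o e']. *)
have [|theta' [e' [a [th' th_ok' a1 ha]]]] := one (h j \o e) eta eta0.
  by move=> t Mt; apply: h1; [rewrite inE eqxx|exact: eA].
have [thA' _ _ eA' te'] := th'.
exists (theta \o theta'), (e \o e'), (fun k => if k == j then a else b k).
split=> [||k|k t]; [exact: xprune_comp th'|exact: okM|by case: ifP|].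
by rewrite inE /=; case: eqP => [-> _ /ha//|_ /= kl Mt]; exact/hb/eA'.
Qed.

(** Applying [good] to a map that does not depend on its first argument. *)
Lemma good_stabilize A p (P1 : forall t, MAX A t -> isum A p t = 1) :
  good A p -> forall (J : eqType) (l : seq J) (h : J -> seq (Ord * D) -> R) eta,
  0 < eta -> (forall j t, j \in l -> MAX A t -> -1 <= h j t <= 1) ->
  exists theta e (b : J -> R), [/\ xprune A A theta e, forall j, -1 <= b j <= 1
    & forall j t, j \in l -> MAX A t -> `|h j (e t) - b j| <= eta].
Proof.
move=> gA J l h eta eta0 h1.
have [|||theta [e [b [th _ b1 hb]]]] :=
  @stabilize_seq A (fun=> True) _ _ _ J l h eta eta0 h1 => //; last by exists theta, e, b.
move=> {}h {}eta {}eta0 {}h1.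
have [|theta [e [a [[th lo up] a1]]]] := gA eta (fun _ t => h t) eta0.
  by move=> s t [_ _ /= Mt]; exact: h1.
have [_ _ _ eA _] := th.
exists theta, e, a; split=> // t Mt.
(* The lower bound is used at [s = t]; the upper bound is one on [h (e t)] because the total weight
   is 1. *)
rewrite ler_norml; apply/andP; split.
  by rewrite lerBrDr addrC; exact: lo (MAX_in Mt) Mt (initseg_refl t).
by move: (up _ Mt); rewrite isum_mulr P1 ?mul1r; [rewrite lerBlDl addrC|exact: eA].
Qed.

End Prunings.

(** * The trees [Omega xi]: disjoint pieces, maximal nodes, embeddings *)

Lemma filter_nil (T : Type) (a : pred T) (s : seq T) :
  all (predC a) s -> [seq x <- s | a x] = [::].
Proof. by elim: s => //= x s IH /andP[/negbTE ->]. Qed.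

Section Structure.
Variable D : Type.
Hypothesis D_inh : inhabited D.
Implicit Types (s t u v : seq (Ord * D)) (xi z : Ord).

Lemma oshiftD0 t : oshiftD ozero t = t.
Proof.
by rewrite /oshiftD -[RHS]map_id; apply: eq_map => -[x U]; rewrite oadd0l.
Qed.

Lemma unzip1_oshiftP c (s0 : seq Ord) t : unzip1 t = oshift c s0 ->
  exists2 t0, t = oshiftD c t0 & unzip1 t0 = s0.
Proof.
move=> tE; have sz : size s0 = size t.
  by rewrite -(size_map (oadd c)) -/(oshift c s0) -tE size_map.
have u1 : unzip1 (zip s0 (unzip2 t)) = s0 by rewrite unzip1_zip// size_map sz.
exists (zip s0 (unzip2 t)) => //.
rewrite -[LHS]zip_unzip -[RHS]zip_unzip unzip1_oshiftD u1 tE; congr zip.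
rewrite /oshiftD /unzip2 -map_comp.
by rewrite [RHS](_ : _ = unzip2 (zip s0 (unzip2 t)))// unzip2_zip// size_map sz.
Qed.

(** Since [D] has an element, every extension inside [S] can be decorated, so maximality depends on
    the ordinals alone. *)
Lemma MAX_decorate (S : set (seq Ord)) t :
  MAX (@decorate D S) t <-> MAX S (unzip1 t).
Proof.
have [U0] := D_inh.
split=> -[St m]; split=> // t' St' [w t'E].
  have : t ++ [seq (x, U0) | x <- w] = t.
    apply: m; last exact: initseg_cat.
    by rewrite /decorate /= /unzip1 map_cat -map_comp map_id -t'E.
  move=> /(congr1 size); rewrite size_cat size_map -[X in _ = X]addn0 => /addnI.
  by case: w t'E => // ->; rewrite cats0.
have : unzip1 t' = unzip1 t.
  by apply: m => //; rewrite t'E /unzip1 map_cat; exact: initseg_cat.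
rewrite t'E /unzip1 map_cat => /(congr1 size); rewrite size_cat -[X in _ = X]addn0.
by move=> /addnI; case: w {t'E} => //; rewrite cats0.
Qed.

Lemma Omega0E (U : D) : Omega ozero [:: (ozero, U)].
Proof. by rewrite /Omega /decorate Gamma0. Qed.

Lemma Omega0P t : Omega ozero t -> exists U, t = [:: (ozero, U)].
Proof.
by rewrite /Omega /decorate Gamma0; case: t => [|[x U] [|y t]]//= [->]; exists U.
Qed.

Lemma Omega_succ xi : @Omega D (osucc xi) = \bigcup_n OmegaN xi n.+1.
Proof.
apply/seteqP; split=> t; rewrite /Omega /decorate /= GammaS.
  by move=> [[//|n] _ tn]; exists n.
by move=> [n _ tn]; exists n.+1.
Qed.

Lemma Omega_lim xi : olimit xi -> @Omega D xi =
  \bigcup_(z : {z | (z < xi)%O}) (oshiftD (opow (sval z)) @` Omega (osucc (sval z))).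
Proof.
move=> lx; apply/seteqP; split=> t; rewrite /Omega /decorate /= Gamma_lim//.
  move=> [z /= zx [s Gs /esym/unzip1_oshiftP[t0 -> t0E]]].
  by exists (exist _ z zx) => //=; exists t0 => //; rewrite /Omega /decorate /= t0E.
move=> [[z zx] _ /= [t0 Ot0 <-]]; exists z => //; exists (unzip1 t0) => //.
by rewrite unzip1_oshiftD.
Qed.

Lemma OmegaN_lt xi n t : OmegaN xi n t ->
  all (fun x => (x.1 < omuln (opow xi) n)%O) t /\ t <> [::].
Proof.
move=> /GammaN_lt[]; rewrite all_map => tn t0; split=> // tE.
by apply: t0; rewrite tE.
Qed.

Lemma Omega_lt xi t : Omega xi t -> all (fun x => (x.1 < opow xi)%O) t /\ t <> [::].
Proof.
by move=> Ot; have := @OmegaN_lt xi 1 t Ot; rewrite omuln1.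
Qed.

Lemma initseg_head s t : initseg s t -> s <> [::] ->
  head ozero (unzip1 s) = head ozero (unzip1 t).
Proof. by move=> [u ->]; case: s. Qed.

(** Comparable nonempty sequences share their first term, which for [OmegaN xi i.+1] lies between
    omega ^ xi * i and omega ^ xi * (i + 1), the latter excluded. *)
Lemma OmegaN_disj xi i j s t : OmegaN xi i.+1 s -> OmegaN xi j.+1 t ->
  initseg s t -> i = j.
Proof.
move=> Os Ot st; have [_ s0] := OmegaN_lt Os.
have /andP[i1 i2] := GammaN_head Os; have /andP[j1 j2] := GammaN_head Ot.
rewrite (initseg_head st s0) in i1 i2.
have mono k l : (omuln (opow xi) k < omuln (opow xi) l)%O -> (k < l)%N.
  move=> kl; rewrite ltnNge leq_eqVlt; apply/negP => /predU1P[lk|lk].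
    by rewrite lk ltxx in kl.
  by have := lt_trans kl (omuln_lt (opow_gt0 xi) lk); rewrite ltxx.
apply/eqP; rewrite eqn_leq -ltnS (mono _ _ (le_lt_trans i1 j2)).
by rewrite -ltnS (mono _ _ (le_lt_trans j1 i2)).
Qed.

(** Again the first term decides: for the summand of [z] it lies in the interval from omega ^ z to
    omega ^ z + omega ^ (z + 1), and these intervals are disjoint by [opow_add]. *)
Lemma Omega_lim_disj xi (i j : {z | (z < xi)%O}) s t :
  (oshiftD (opow (sval i)) @` Omega (osucc (sval i))) s ->
  (oshiftD (opow (sval j)) @` Omega (osucc (sval j))) t -> initseg s t -> i = j.
Proof.
have hd y v : Omega (osucc y) v -> (opow y <= head ozero (unzip1 (oshiftD (opow y) v))
    < oadd (opow y) (opow (osucc y)))%O.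
  move=> /Omega_lt[]; case: v => // -[x U] v /= /andP[xy _] _.
  by rewrite ole_add oadd_ltl.
case: i j => [y yx] [z zx] /= [s0 Os0 sE] [t0 Ot0 tE] st.
have s1 : s <> [::] by rewrite -sE; have [_] := Omega_lt Os0; case: (s0).
have := initseg_head st s1; rewrite -sE -tE => e.
have /andP[y1 y2] := hd _ _ Os0; have /andP[z1 z2] := hd _ _ Ot0.
have yz : y = z.
  case: (ltgtP y z) => // h; exfalso.
    have := le_lt_trans (le_trans (opow_add h) z1) (_ : _ < _)%O.
    by rewrite -e => /(_ _ y2); rewrite ltxx.
  have := le_lt_trans (le_trans (opow_add h) y1) (_ : _ < _)%O.
  by rewrite e => /(_ _ z2); rewrite ltxx.
by move: zx; rewrite -yz => zx; congr exist; exact: Prop_irrelevance.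
Qed.

Lemma MAX_Omega_succ xi t : MAX (Omega (osucc xi)) t <-> exists n, MAX (OmegaN xi n.+1) t.
Proof. by rewrite Omega_succ; apply: MAX_union => i j s u; exact: OmegaN_disj. Qed.

Lemma MAX_Omega_lim xi t : olimit xi -> MAX (Omega xi) t <->
  exists z s, [/\ (z < xi)%O, MAX (Omega (osucc z)) s & t = oshiftD (opow z) s].
Proof.
move=> lx; rewrite Omega_lim//; split.
  move=> /MAX_union[|[z zx] Mt]; first by move=> i j s u; exact: Omega_lim_disj.
  have [s _ sE] := MAX_in Mt; exists z, s; split=> //.
  by move: Mt; rewrite -sE => /MAX_image_oshiftD.
move=> [z [s [zx Ms ->]]]; apply/MAX_union.
  by move=> i j ? u; exact: Omega_lim_disj.
by exists (exist _ z zx); apply/MAX_image_oshiftD.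
Qed.

Lemma MAX_Omega_ex xi : exists t, MAX (@Omega D xi) t.
Proof.
elim/ord_ind: xi => xi IH.
have [->|[z xz]|lx] := Ord_cases xi.
- have [U] := D_inh; exists [:: (ozero, U)]; split; first exact: Omega0E.
  by move=> t /Omega0P[V ->] [[|//] [->]].
- have [|t Mt] := IH z; first by rewrite xz lt_osucc.
  by exists t; rewrite xz; apply/MAX_Omega_succ; exists 0%N.
- have x0 : (ozero < xi)%O by rewrite lt_neqAle ozero_le andbT eq_sym; apply/eqP; case: lx.
  have [t Mt] := IH _ (lx.2 _ x0).
  by exists (oshiftD (opow ozero) t); apply/MAX_Omega_lim => //; exists ozero, t.
Qed.

(** A shift suffices: [Omega y] is the layer [n = 1] of [Omega (osucc y)], and at a limit the
    summand of [z] contains a shifted copy of [Omega z]. Each inclusion keeps maximal nodes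
    maximal. *)
Lemma Omega_embed z xi : (z <= xi)%O -> exists c,
  (forall t, @Omega D z t -> Omega xi (oshiftD c t)) /\
  (forall t, MAX (@Omega D z) t -> MAX (Omega xi) (oshiftD c t)).
Proof.
elim/ord_ind: xi => xi IH; rewrite le_eqVlt => /predU1P[->|zx].
  by exists ozero; split=> t; rewrite oshiftD0.
have [x0|[y xy]|lx] := Ord_cases xi.
- by rewrite x0 olt0 in zx.
- have zy : (z <= y)%O by rewrite -lt_osuccE -xy.
  have [|c [cO cM]] := IH y _ zy; first by rewrite xy lt_osucc.
  rewrite xy; exists c; split=> t.
    by rewrite Omega_succ => /cO ?; exists 0%N.
  by move=> /cM ?; apply/MAX_Omega_succ; exists 0%N.
- exists (opow z); split=> t Ot.
    rewrite Omega_lim//; exists (exist _ z zx) => //; exists t => //=.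
    by rewrite Omega_succ; exists 0%N.
  apply/MAX_Omega_lim => //; exists z, t; split=> //.
  by apply/MAX_Omega_succ; exists 0%N.
Qed.

(** * Levels, blocks and unit bases in [OmegaN xi n] *)

Section Levels.
Variable xi : Ord.

Definition below n t := all (fun x => (x.1 < omuln (opow xi) n)%O) t.

(** The recursive shape of the members of [OmegaN xi n.+1]: a first block [t] and the remaining
    levels [u], possibly empty. Terms of the shifted block are at least omega ^ xi * n and those of
    [u] are smaller, so filtering by this threshold recovers both parts. *)
Definition node n t u := oshiftD (omuln (opow xi) n) t ++ u.

Definition first_part n t := [seq x <- t | (omuln (opow xi) n <= x.1)%O].

Definition rest n t := [seq x <- t | (x.1 < omuln (opow xi) n)%O].

Lemma first_part_node n t u : below n u ->
  first_part n (node n t u) = oshiftD (omuln (opow xi) n) t.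
Proof.
move=> un; rewrite /first_part filter_cat -[RHS]cats0; congr cat.
  by apply/all_filterP; rewrite all_map; apply/allT => x; exact: ole_add.
apply: filter_nil.
by apply: sub_all un => x /=; rewrite ltNge.
Qed.

Lemma rest_node n t u : below n u -> rest n (node n t u) = u.
Proof.
move=> un; rewrite /rest filter_cat -[RHS]cat0s; congr cat.
  by apply: filter_nil; rewrite all_map; apply/allT => x /=; rewrite -leNgt ole_add.
exact/all_filterP.
Qed.

Lemma node_inj n t u t' u' : below n u -> below n u' ->
  node n t u = node n t' u' -> t = t' /\ u = u'.
Proof.
move=> un un' e; split; last by rewrite -(rest_node t un) e rest_node.
apply: (@oshiftD_inj _ (omuln (opow xi) n)).
by rewrite -(first_part_node t un) e first_part_node.
Qed.

Lemma initseg_node n t u t' u' : below n u -> below n u' ->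
  initseg (node n t u) (node n t' u') -> initseg t t' /\ initseg u u'.
Proof.
move=> un un' i; split.
  apply/(initseg_oshiftD (omuln (opow xi) n)).
  rewrite -(first_part_node t un) -(first_part_node t' un').
  exact: initseg_filter.
by rewrite -(rest_node t un) -(rest_node t' un'); exact: initseg_filter.
Qed.

Lemma initseg_node0 n t u t' : initseg t t' -> initseg (node n t [::]) (node n t' u).
Proof.
move=> tt'; rewrite /node cats0; apply: initseg_trans (initseg_cat _ _).
exact/initseg_oshiftD.
Qed.

Lemma OmegaN_below n t : OmegaN xi n t -> below n t /\ t <> [::].
Proof. exact: OmegaN_lt. Qed.

(** A uniform recursion that includes [n = 0]: as [GammaN xi 0] is empty, only [w = [::]] remains
    there. *)
Lemma GammaN_S n (s : seq Ord) : GammaN xi n.+1 s <-> exists s0 w : seq Ord,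
  s = oshift (omuln (opow xi) n) s0 ++ w /\
  (w = [::] /\ Gamma xi s0 \/ MAX (Gamma xi) s0 /\ GammaN xi n w).
Proof.
have MAXsh c (s0 : seq Ord) : MAX (Gamma xi) s0 -> MAX (oshift c @` Gamma xi) (oshift c s0).
  move=> [G0 m]; split; first by exists s0.
  move=> _ [s1 G1 <-] /initseg_takeE; rewrite size_map -map_take => /oshift_inj e.
  by rewrite (m s1)//; rewrite e; exact: initseg_take.
case: n => [|n].
  rewrite /GammaN /=; split=> [Gs|[s0 [w [-> [[-> ?]|[_ //]]]]]].
    by exists s, [::]; rewrite oshift0 cats0; split=> //; left.
  by rewrite oshift0 cats0.
rewrite /GammaN layersSS -/(GammaN xi n.+1); split.
  move=> [[s0 G0 <-]|[_ [w [/MAX_oshift[s0 M0 ->] Gw ->]]]].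
    by exists s0, [::]; rewrite cats0; split=> //; left.
  by exists s0, w; split=> //; right.
move=> [s0 [w [-> [[-> G0]|[M0 Gw]]]]].
  by rewrite cats0; left; exists s0.
by right; exists (oshift (omuln (opow xi) n.+1) s0), w; split=> //; exact: MAXsh.
Qed.

Lemma OmegaN_S n t : OmegaN xi n.+1 t <-> exists t0 u, t = node n t0 u /\
  (u = [::] /\ Omega xi t0 \/ MAX (Omega xi) t0 /\ OmegaN xi n u).
Proof.
split.
  move=> /GammaN_S[s0 [w [tE H]]]; pose k := size s0.
  have t1 : unzip1 (take k t) = oshift (omuln (opow xi) n) s0.
    by rewrite /unzip1 map_take -/(unzip1 t) tE take_size_cat// size_map.
  have t2 : unzip1 (drop k t) = w.
    by rewrite /unzip1 map_drop -/(unzip1 t) tE drop_size_cat// size_map.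
  have [t0 t0E t01] := unzip1_oshiftP t1.
  exists t0, (drop k t); rewrite /node -t0E cat_take_drop; split=> //.
  case: H => -[H1 H2]; [left|right].
    by rewrite /Omega /decorate /= t01; split=> //; move: t2; rewrite H1; case: drop.
  by rewrite /OmegaN /decorate /= t2; split=> //; apply/MAX_decorate; rewrite t01.
move=> [t0 [u [-> H]]]; apply/GammaN_S; exists (unzip1 t0), (unzip1 u); split.
  by rewrite /node /unzip1 map_cat -unzip1_oshiftD.
case: H => -[H1 H2]; [left|right]; first by rewrite H1.
by split=> //; apply/MAX_decorate.
Qed.

Lemma OmegaN_node0 n t : Omega xi t -> OmegaN xi n.+1 (node n t [::]).
Proof. by move=> Ot; apply/OmegaN_S; exists t, [::]; split=> //; left. Qed.

Lemma OmegaN_node n t u : MAX (Omega xi) t -> OmegaN xi n u -> OmegaN xi n.+1 (node n t u).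
Proof. by move=> Mt Ou; apply/OmegaN_S; exists t, u; split=> //; right. Qed.

Lemma OmegaN_node0P n t : OmegaN xi n.+1 (node n t [::]) -> Omega xi t.
Proof.
move=> /OmegaN_S[t0 [u [e [[uE]|[_ /OmegaN_below[un u0]]]]]].
  by move: e; rewrite uE => /node_inj[|//|->].
by move: e => /node_inj[//|//|_ uE]; case: u0.
Qed.

Lemma OmegaN_nodeP n t u : below n u -> u <> [::] ->
  OmegaN xi n.+1 (node n t u) -> MAX (Omega xi) t /\ OmegaN xi n u.
Proof.
move=> un u0 /OmegaN_S[t0 [u' [e [[uE]|[Mt Ou']]]]].
  by move: e; rewrite uE => /node_inj[//|//|_ ue]; case: u0.
by have [u'n _] := OmegaN_below Ou'; move: e => /node_inj[//|//|-> ->].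
Qed.

Lemma node0n t : node 0 t [::] = t.
Proof. by rewrite /node cats0 oshiftD0. Qed.

Lemma MAX_node n t u : MAX (Omega xi) t -> MAX (OmegaN xi n.+1) u ->
  MAX (OmegaN xi n.+2) (node n.+1 t u).
Proof.
move=> Mt Mu; have [un u0] := OmegaN_below (MAX_in Mu); split.
  by apply: OmegaN_node => //; exact: MAX_in.
move=> _ /OmegaN_S[t' [u' [-> [[-> Ot']|[Mt' Ou']]]]].
  by move=> /initseg_node[//|//|_ /initseg_nil].
have [un' u0'] := OmegaN_below Ou'.
move=> /initseg_node[//|//|tt' uu']; congr node.
  by rewrite (MAX_initseg Mt (MAX_in Mt') tt').
by rewrite (MAX_initseg Mu Ou' uu').
Qed.

Lemma MAX_OmegaN_ex n : exists t, MAX (@OmegaN D xi n.+1) t.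
Proof.
have [t Mt] := MAX_Omega_ex xi.
elim: n => [|n [u Mu]]; first by exists t.
by exists (node n.+1 t u); exact: MAX_node.
Qed.

Lemma MAX_nodeP n t : MAX (OmegaN xi n.+2) t ->
  exists t0 u, [/\ t = node n.+1 t0 u, MAX (Omega xi) t0 & MAX (OmegaN xi n.+1) u].
Proof.
move=> [/OmegaN_S[t0 [u [-> [[-> O0]|[M0 Ou]]]]] m]; last first.
  exists t0, u; split=> //; split=> // u' Ou' uu'.
  have [un _] := OmegaN_below Ou; have [un' _] := OmegaN_below Ou'.
  have := m _ (OmegaN_node M0 Ou'); rewrite initseg_catl => /(_ uu').
  by move=> /node_inj[//|//|_].
(* Empty upper levels contradict maximality: [t0] would have to be maximal, and then a member of
   [OmegaN n.+1] could be appended. *)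
have M0 : MAX (Omega xi) t0.
  split=> // t' Ot' tt'; have := m _ (OmegaN_node0 n.+1 Ot').
  by move=> /(_ (initseg_node0 _ _ tt'))/node_inj[//|//|].
have [u' Mu'] := MAX_OmegaN_ex n; have [un' u0'] := OmegaN_below (MAX_in Mu').
have := m _ (OmegaN_node M0 (MAX_in Mu')).
by move=> /(_ (initseg_node0 _ _ (initseg_refl _)))/node_inj[//|//|_ /u0'].
Qed.

(** The level, counted from [0]. *)
Fixpoint level n t : nat := if n is m.+1 then
  if rest m t is [::] then 0%N else (level m (rest m t)).+1 else 0%N.

(** The concatenation of all blocks but the last one; two nodes lie in the same
    unit if and only if it is the same for both. *)
Fixpoint unit_base n t : seq (Ord * D) := if n is m.+1 then
  if rest m t is [::] then [::] else first_part m t ++ unit_base m (rest m t)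
  else [::].

(** The map iota in a form suited to induction on [n]; [last_block_top] identifies it with
    [last_block] on [OmegaN xi n]. *)
Fixpoint top_block n t : seq (Ord * D) := if n is m.+1 then
  if rest m t is [::] then unshift (omuln (opow xi) m) (first_part m t)
  else top_block m (rest m t) else t.

Lemma level_node0 n t : level n.+1 (node n t [::]) = 0%N.
Proof. by rewrite /= rest_node. Qed.

Lemma level1 t : level 1 t = 0%N.
Proof. by rewrite -[t]node0n level_node0. Qed.

Lemma level_nodeS n t u : below n u -> u <> [::] ->
  level n.+1 (node n t u) = (level n u).+1.
Proof. by move=> un u0 /=; rewrite rest_node//; case: u u0 un. Qed.

Lemma unit_base_node0 n t : unit_base n.+1 (node n t [::]) = [::].
Proof. by rewrite /= rest_node. Qed.

Lemma unit_base_nodeS n t u : below n u -> u <> [::] ->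
  unit_base n.+1 (node n t u) = node n t (unit_base n u).
Proof.
by move=> un u0 /=; rewrite rest_node// first_part_node//; case: u u0 un.
Qed.

Lemma top_block_node0 n t : top_block n.+1 (node n t [::]) = t.
Proof. by rewrite /= rest_node// first_part_node// oshiftDK. Qed.

Lemma top_block_nodeS n t u : below n u -> u <> [::] ->
  top_block n.+1 (node n t u) = top_block n u.
Proof. by move=> un u0 /=; rewrite rest_node//; case: u u0 un. Qed.

Lemma level_lt n t : OmegaN xi n t -> (level n t < n)%N.
Proof.
elim: n t => // n IH _ /OmegaN_S[t [u [-> [[-> _]|[_ Ou]]]]].
  by rewrite level_node0.
by have [un u0] := OmegaN_below Ou; rewrite level_nodeS// ltnS IH.
Qed.

End Levels.
End Structure.

(** * Weights along a branch, level by level *)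

Definition lsum (R : realType) (D : Type) (xi : Ord) (n i : nat)
    (G : seq (Ord * D) -> R) (t : seq (Ord * D)) : R :=
  isum (fun s => OmegaN xi n s /\ level xi n s = i) G t.

Section Weights.
Variables (R : realType) (D : Type).
Hypothesis D_inh : inhabited D.
Implicit Types (s t u v : seq (Ord * D)) (xi z : Ord) (G : seq (Ord * D) -> R).

(** An initial segment of [node xi n t v] in the tree is on level 0 exactly when it ends within the
    first block; [lsumS] treats those ending later, whose level drops by one once the first block is
    removed. *)
Lemma lsum0 xi n G t v : below xi n v ->
  lsum xi n.+1 0 G (node xi n t v) = isum (Omega xi) (fun s => G (node xi n s [::])) t.
Proof.
move=> vn; rewrite /lsum isum_cat [X in _ + X]isum0 => [|w wv [w0 [_]]]; last first.
  by rewrite level_nodeS//; exact: initseg_all vn.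
rewrite addr0 isum_map; apply: eq_isum => s st; rewrite -/(oshiftD _ _).
  have -> : oshiftD (omuln (opow xi) n) s = node xi n s [::] by rewrite /node cats0.
  split=> [[/(OmegaN_node0P D_inh)]//|Os]; split; last exact: level_node0.
  exact: OmegaN_node0.
by rewrite /node cats0.
Qed.

Lemma lsumS xi n i G t v : MAX (Omega xi) t -> below xi n v ->
  lsum xi n.+1 i.+1 G (node xi n t v) = lsum xi n i (fun u => G (node xi n t u)) v.
Proof.
move=> Mt vn; rewrite /lsum isum_cat isum0 => [|s st [_]]; last first.
  have [k ->] : exists k, s = oshiftD (omuln (opow xi) n) (take k t).
    by exists (size s); rewrite [LHS](initseg_takeE st) /oshiftD map_take.
  by rewrite -[oshiftD _ _]cats0 -/(node xi n _ _) level_node0.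
rewrite add0r; apply: eq_isum => // u uv; have un := initseg_all uv vn.
rewrite -/(node xi n t u); split.
  by move=> [u0 [/(OmegaN_nodeP D_inh un u0)[_ Ou]]]; rewrite level_nodeS// => -[].
move=> [Ou ui]; have [_ u0] := OmegaN_below Ou.
by rewrite level_nodeS// ui; split=> //; split=> //; exact: OmegaN_node.
Qed.

Lemma isum_lsum xi n G t :
  isum (OmegaN xi n) G t = \sum_(i < n) lsum xi n i G t.
Proof.
rewrite /lsum /isum (eq_bigr (fun i : 'I_n => \sum_(s <- initsegs t)
  if `[< OmegaN xi n s /\ level xi n s = i >] then G s else 0)); last first.
  by move=> i _; rewrite big_mkcond.
rewrite exchange_big big_mkcond; apply: eq_bigr => s _ /=.
case: asboolP => [Os|nO]; last by rewrite big1// => i _; case: asboolP => // -[].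
rewrite (bigD1 (Ordinal (level_lt D_inh Os)))//= asboolT// big1 ?addr0// => i /eqP ni.
by case: asboolP => // -[_ e]; case: ni; apply: val_inj.
Qed.

Lemma blocks_node0 xi n t : Omega xi t ->
  is_blocks xi n.+1 (unzip1 (node xi n t [::])) [:: unzip1 t].
Proof.
move=> Ot; split=> [||[]|]//.
by rewrite unblocks_cons /unblocks /= /node !cats0 unzip1_oshiftD.
Qed.

Lemma blocks_nodeS xi n t u ts : MAX (Omega xi) t ->
  is_blocks xi n (unzip1 u) ts ->
  is_blocks xi n.+1 (unzip1 (node xi n t u)) (unzip1 t :: ts).
Proof.
move=> Mt [/andP[_ tsn] uE Gts Mts]; split=> //.
- by rewrite unblocks_cons -uE -unzip1_oshiftD /node /unzip1 map_cat.
- by case=> [_|i /Gts//]; exact: MAX_in Mt.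
- by case=> [_|i /Mts//]; exact/(MAX_decorate D_inh).
Qed.

Lemma level_blocks xi n t ts : OmegaN xi n t -> is_blocks xi n (unzip1 t) ts ->
  size ts = (level xi n t).+1.
Proof.
elim: n t ts => // n IH _ ts /(OmegaN_S D_inh)[t [u [-> [[-> Ot]|[Mt Ou]]]]] tsP.
  by rewrite level_node0 (is_blocks_uniq tsP (blocks_node0 n Ot)).
have [us usP] := is_blocks_ex Ou; have [un u0] := OmegaN_below Ou.
by rewrite level_nodeS// (is_blocks_uniq tsP (blocks_nodeS Mt usP)) /= (IH u).
Qed.

(** Uniqueness of the decomposition into blocks links [Lambda], which counts from 1, to [level],
    which counts from 0. *)
Lemma LambdaE xi n i t : Lambda xi n i.+1 t <-> OmegaN xi n t /\ level xi n t = i.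
Proof.
split=> [[Ot [ts tsP tsi]]|[Ot <-]]; split=> //.
  by apply/eq_add_S; rewrite -(level_blocks Ot tsP).
have [ts tsP] := is_blocks_ex Ot; exists ts => //.
by rewrite (level_blocks Ot tsP).
Qed.

Lemma size_last_block xi n (s : seq Ord) ts : is_blocks xi n s ts ->
  (size (last [::] ts) <= size s)%N.
Proof.
move=> [/andP[ts0 _] -> _ _]; rewrite /unblocks.
elim/last_ind: ts ts0 => // us u _ _; rewrite last_rcons size_rcons.
rewrite -addn1 iotaD map_cat flatten_cat size_cat /= cats0 size_map.
by rewrite add0n nth_rcons ltnn eqxx leq_addl.
Qed.

Lemma last_block_top xi n t : OmegaN xi n t -> last_block xi n t = top_block xi n t.
Proof.
elim: n t => // n IH _ /(OmegaN_S D_inh)[t [u [-> [[-> Ot]|[Mt Ou]]]]].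
  rewrite top_block_node0 /last_block.
  have tP := blocks_node0 n Ot.
  rewrite (is_blocks_uniq (blocksP (OmegaN_node0 D_inh n Ot)) tP) /=.
  rewrite /node cats0 !size_map subnn drop0 -[RHS]zip_unzip; congr zip.
  by rewrite /oshiftD /unzip2 -map_comp.
have [un u0] := OmegaN_below Ou; have uP := blocksP Ou.
rewrite top_block_nodeS// -IH// /last_block.
rewrite (is_blocks_uniq (blocksP (OmegaN_node D_inh Mt Ou)) (blocks_nodeS Mt uP)).
have b0 : (0 < size (blocks xi n (unzip1 u)))%N by case: uP => /andP[].
have -> : last [::] (unzip1 t :: blocks xi n (unzip1 u)) =
    last [::] (blocks xi n (unzip1 u)) by case: (blocks _ _ _) b0.
have := size_last_block uP; rewrite size_map => le_u.
rewrite /node size_cat -addnBA// /unzip2 map_cat; congr zip.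
by rewrite drop_cat size_map ltnNge leq_addr /= addKn.
Qed.

Lemma prob_ge0 xi t : 0 <= prob xi t :> R.
Proof.
rewrite /prob; case: xgetP => // p _ gp.
by elim: gp => // [z n s q n0 _ _ q0]; rewrite mulr_ge0// invr_ge0.
Qed.

(** A maximal branch runs through a complete maximal block on every level. The total weight at [xi]
    is a hypothesis because [isum_prob] calls this lemma in its induction on [xi]. *)
Lemma lsum_prob xi n i t : (forall s, MAX (Omega xi) s -> isum (Omega xi) (prob xi) s = 1 :> R) ->
  (i < n.+1)%N -> MAX (OmegaN xi n.+1) t ->
  lsum xi n.+1 i (fun s => prob xi (top_block xi n.+1 s)) t = 1 :> R.
Proof.
move=> P1; have P0 m v s : MAX (Omega xi) s -> below xi m v ->
    lsum xi m.+1 0 (fun s => prob xi (top_block xi m.+1 s)) (node xi m s v) = 1 :> R.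
  move=> Ms vm; rewrite lsum0// -[RHS](P1 s Ms).
  by apply: eq_isum => // u _ _; rewrite top_block_node0.
elim: n i t => [|n IH] i t.
  by case: i => // _ Mt; rewrite -[t](node0n xi) P0.
move=> i_lt /(MAX_nodeP D_inh)[s [u [-> Ms Mu]]].
have [un _] := OmegaN_below (MAX_in Mu).
case: i i_lt => [_|i i_lt]; first exact: P0.
rewrite lsumS// -[RHS](IH i u)//; apply: eq_isum => // v vu [/OmegaN_below[vn v0] _].
by rewrite top_block_nodeS.
Qed.

Lemma prob_top xi n t : OmegaN xi n.+1 t ->
  prob (osucc xi) t = n.+1%:R^-1 * prob xi (top_block xi n.+1 t) :> R.
Proof. by move=> Ot; rewrite (probS R _ Ot)// last_block_top. Qed.

Lemma isum_Omega_succ xi n G t : MAX (OmegaN xi n.+1) t ->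
  isum (Omega (osucc xi)) G t = isum (OmegaN xi n.+1) G t.
Proof.
move=> Mt; apply: eq_isum => // s st; rewrite Omega_succ; split.
  by move=> [m _ Os]; rewrite -(OmegaN_disj Os (MAX_in Mt) st).
by move=> Os; exists n.
Qed.

Lemma isum_Omega_lim xi z G s : olimit xi -> (z < xi)%O ->
  Omega (osucc z) s -> isum (Omega xi) G (oshiftD (opow z) s) =
  isum (Omega (osucc z)) (fun u => G (oshiftD (opow z) u)) s.
Proof.
move=> lx zx Os; rewrite isum_map; apply: eq_isum => // u us.
rewrite -/(oshiftD _ _) Omega_lim//; split=> [[j _ Kj]|Ou]; last first.
  by exists (exist _ z zx) => //; exists u.
have jz := @Omega_lim_disj _ _ j (exist _ z zx) _ (oshiftD (opow z) s) Kj
  (ex_intro2 _ _ s Os erefl) (initseg_map _ us).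
by move: Kj; rewrite jz => -[v Ov /= /oshiftD_inj <-].
Qed.

(** At a successor, the [n + 1] levels each have weight 1 before division by [n + 1]; at a limit,
    the branch lies in a single shifted summand. *)
Lemma isum_prob xi t : MAX (Omega xi) t -> isum (Omega xi) (prob xi) t = 1 :> R.
Proof.
elim/ord_ind: xi t => xi IH t.
have [->|[z xz]|lx] := Ord_cases xi.
- move=> [/Omega0P[U ->] _]; rewrite /isum /initsegs /= !big_cons big_nil.
  (* [initsegs] also lists the empty sequence, which is not in [Omega ozero]. *)
  rewrite asboolF; last by move=> /Omega0P[].
  by rewrite asboolT ?prob0 ?addr0//; exact: Omega0E.
- rewrite xz => /MAX_Omega_succ[n Mt]; rewrite (isum_Omega_succ _ Mt).
  rewrite (eq_isum (Q' := OmegaN z n.+1)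
    (G' := fun s => n.+1%:R^-1 * prob z (top_block z n.+1 s)))//; last first.
    by move=> s _; exact: prob_top.
  rewrite isum_mull isum_lsum (eq_bigr (fun=> 1)) => [|i _]; last first.
    by apply: lsum_prob => // s; apply: IH; rewrite xz lt_osucc.
  by rewrite sumr_const card_ord mulVf// pnatr_eq0.
- move=> /(MAX_Omega_lim _ lx)[z [s [zx Ms ->]]].
  rewrite isum_Omega_lim//; last exact: MAX_in.
  transitivity (isum (Omega (osucc z)) (prob (osucc z)) s : R); last exact: IH (lx.2 _ zx) _ Ms.
  by apply: eq_isum => // u _ Ou; rewrite prob_lim.
Qed.

End Weights.

(** * Prunings assembled from the first level and the levels above it *)

Section LevelInduction.
Variables (R : realType) (D : Type) (leD : D -> D -> Prop).
Hypothesis dirD : directed_set leD.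
Variable xi : Ord.
Implicit Types (s t u v w : seq (Ord * D)) (n m i : nat).
Implicit Types (theta e : seq (Ord * D) -> seq (Ord * D)).
Implicit Types (f : seq (Ord * D) -> seq (Ord * D) -> R).

Let D_inh : inhabited D. Proof. by case: dirD. Qed.

Local Notation OmegaN := (@OmegaN D xi).
Local Notation Omega := (@Omega D xi).

Definition bottom n t : seq (Ord * D) := unshift (omuln (opow xi) n) (first_part xi n t).

Lemma bottom_node n t u : below xi n u -> bottom n (node xi n t u) = t.
Proof. by move=> un; rewrite /bottom first_part_node// oshiftDK. Qed.

(** The action of [theta1] on the first level and, above each maximal node [t]
    of it, of [thetas t] on the remaining levels; [e1 t] becomes the new first
    block. *)
Definition node_theta n m theta1 e1 (thetas : seq (Ord * D) -> seq (Ord * D) -> seq (Ord * D)) t :=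
  if rest xi n t is [::] then node xi m (theta1 (bottom n t)) [::]
  else node xi m (e1 (bottom n t)) (thetas (bottom n t) (rest xi n t)).

Definition node_e n m e1 (es : seq (Ord * D) -> seq (Ord * D) -> seq (Ord * D)) t :=
  node xi m (e1 (bottom n t)) (es (bottom n t) (rest xi n t)).

Lemma node_theta0 n m theta1 e1 thetas t :
  node_theta n m theta1 e1 thetas (node xi n t [::]) = node xi m (theta1 t) [::].
Proof. by rewrite /node_theta rest_node// bottom_node. Qed.

Lemma node_thetaS n m theta1 e1 thetas t u : below xi n u -> u <> [::] ->
  node_theta n m theta1 e1 thetas (node xi n t u) = node xi m (e1 t) (thetas t u).
Proof.
by move=> un u0; rewrite /node_theta rest_node// bottom_node//; case: u u0 un.
Qed.

Lemma node_eE n m e1 es t u : below xi n u ->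
  node_e n m e1 es (node xi n t u) = node xi m (e1 t) (es t u).
Proof. by move=> un; rewrite /node_e rest_node// bottom_node. Qed.

(** Further levels can only follow a maximal block, so nodes above [t] are placed over [e1 t], not
    [theta1 t]; order between the levels holds because [theta1 t] is an initial segment of [e1 t].
    Distinct [n] and [m] occur in [xprune_select]. *)
Lemma xprune_node n m theta1 e1 thetas es :
  xprune leD Omega Omega theta1 e1 ->
  (forall t, MAX Omega t -> xprune leD (OmegaN n.+1) (OmegaN m.+1) (thetas t) (es t)) ->
  xprune leD (OmegaN n.+2) (OmegaN m.+2)
    (node_theta n.+1 m.+1 theta1 e1 thetas) (node_e n.+1 m.+1 e1 es).
Proof.
move=> th1 th2; have [th1O th1l th1lab e1M te1] := th1.
have low k w : OmegaN k w -> below xi k w /\ w <> [::] by exact: OmegaN_below.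
split.
- move=> _ /(OmegaN_S D_inh)[t [u [-> [[-> Ot]|[Mt Ou]]]]].
    by rewrite node_theta0; apply: OmegaN_node0 => //; exact: th1O.
  have [un u0] := low _ _ Ou; have [th2O _ _ _ _] := th2 t Mt.
  by rewrite node_thetaS//; apply: OmegaN_node => //; [exact: e1M|exact: th2O].
- move=> _ _ /(OmegaN_S D_inh)[s [u [-> Hs]]] /(OmegaN_S D_inh)[t [v [-> Ht]]].
  case: Hs => [[-> Os]|[Ms Ou]]; case: Ht => [[-> Ot]|[Mt Ov]].
  + rewrite !node_theta0 /node !cats0 => -[/initseg_oshiftD st sNt].
    by apply: pinitseg_oshiftD; apply: th1l => //; split=> // ste; apply: sNt; rewrite ste.
  + have [vn v0] := low _ _ Ov => -[/initseg_node[//|//|st _] _].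
    rewrite node_theta0 node_thetaS//; have [th2O _ _ _ _] := th2 t Mt.
    have [_ tv0] := low _ _ (th2O _ Ov).
    apply: initseg_pinitseg_trans (pinitseg_cat _ tv0).
    rewrite /node cats0; apply/initseg_oshiftD.
    exact: initseg_trans (xprune_le th1 Os (MAX_in Mt) st) (te1 _ Mt).
  + have [un u0] := low _ _ Ou => -[/initseg_node[//|//|_ /initseg_nil uE] _].
    by case: u0.
  + have [un u0] := low _ _ Ou; have [vn v0] := low _ _ Ov => -[i ne].
    have [st uv] := initseg_node un vn i.
    have stE := MAX_initseg Ms (MAX_in Mt) st; rewrite -{t}stE in Mt st i ne *.
    rewrite !node_thetaS//; apply: pinitseg_catl; have [_ + _ _ _] := th2 s Ms.
    by apply=> //; split=> // uvE; apply: ne; rewrite uvE.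
- move=> _ /(OmegaN_S D_inh)[t [u [-> [[-> Ot]|[Mt Ou]]]]].
    rewrite node_theta0 /node !cats0 => U; rewrite !label_oshiftD; exact: th1lab.
  have [un u0] := low _ _ Ou; have [th2O _ th2lab _ _] := th2 t Mt.
  have [_ tu0] := low _ _ (th2O _ Ou).
  rewrite node_thetaS// => U; rewrite /node !label_cat//; exact: th2lab.
- move=> _ /(MAX_nodeP D_inh)[t [u [-> Mt Mu]]].
  have [un u0] := low _ _ (MAX_in Mu); have [_ _ _ e2M _] := th2 t Mt.
  by rewrite node_eE//; apply: MAX_node => //; [exact: e1M|exact: e2M].
- move=> _ /(MAX_nodeP D_inh)[t [u [-> Mt Mu]]].
  have [un u0] := low _ _ (MAX_in Mu); have [_ _ _ _ te2] := th2 t Mt.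
  by rewrite node_eE// node_thetaS//; apply/initseg_catl; exact: te2.
Qed.

(** A form of unit preservation that composes and passes through the induction on levels: levels are
    kept exactly, and nodes of one unit stay in one unit. *)
Definition unit_map n theta : Prop :=
  (forall s, OmegaN n s -> level xi n (theta s) = level xi n s) /\
  (forall s t, OmegaN n s -> OmegaN n t -> unit_base xi n s = unit_base xi n t ->
    unit_base xi n (theta s) = unit_base xi n (theta t)).

Lemma unit_map_comp n theta theta' : (forall s, OmegaN n s -> OmegaN n (theta' s)) ->
  unit_map n theta -> unit_map n theta' -> unit_map n (theta \o theta').
Proof.
move=> thO [l1 u1] [l2 u2]; split=> [s Os|s t Os Ot st] /=.
  by rewrite l1 ?l2//; exact: thO.
by apply: u1; [exact: thO|exact: thO|exact: u2].
Qed.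

Lemma unit_base_initseg n t : OmegaN n t -> initseg (unit_base xi n t) t.
Proof.
elim: n t => // n IH _ /(OmegaN_S D_inh)[t [u [-> [[-> _]|[_ Ou]]]]].
  by rewrite unit_base_node0; exists (node xi n t [::]).
have [un u0] := OmegaN_below Ou.
by rewrite unit_base_nodeS//; apply/initseg_catl; exact: IH.
Qed.

Lemma unit_map_node n theta1 e1 thetas es :
  xprune leD Omega Omega theta1 e1 ->
  (forall t, MAX Omega t -> xprune leD (OmegaN n.+1) (OmegaN n.+1) (thetas t) (es t)) ->
  (forall t, MAX Omega t -> unit_map n.+1 (thetas t)) ->
  unit_map n.+2 (node_theta n.+1 n.+1 theta1 e1 thetas).
Proof.
move=> th1 th2 um; have [th1O th1l th1lab e1M te1] := th1.
have low k w : OmegaN k w -> below xi k w /\ w <> [::] by exact: OmegaN_below.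
(* Unit bases are empty on the first level only, so two nodes with equal bases are both on it or
   both above it. *)
have node_n0 w u : MAX Omega w -> node xi n.+1 w u <> [::].
  by case=> /Omega_lt[_ w0] _; rewrite /node; case: w w0.
split.
  move=> _ /(OmegaN_S D_inh)[t [u [-> [[-> Ot]|[Mt Ou]]]]].
    by rewrite node_theta0 !level_node0.
  have [un u0] := low _ _ Ou; have [th2O _ _ _ _] := th2 t Mt.
  have [tun tu0] := low _ _ (th2O _ Ou); have [lt _] := um t Mt.
  by rewrite node_thetaS// !level_nodeS// lt.
move=> _ _ /(OmegaN_S D_inh)[s [u [-> Hs]]] /(OmegaN_S D_inh)[t [v [-> Ht]]].
case: Hs => [[-> Os]|[Ms Ou]]; case: Ht => [[-> Ot]|[Mt Ov]].
- by rewrite !node_theta0 !unit_base_node0.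
- have [vn v0] := low _ _ Ov; rewrite unit_base_node0 unit_base_nodeS//.
  by move=> /esym/node_n0-/(_ Mt).
- have [un u0] := low _ _ Ou; rewrite unit_base_node0 unit_base_nodeS//.
  by move=> /node_n0-/(_ Ms).
- have [un u0] := low _ _ Ou; have [vn v0] := low _ _ Ov.
  rewrite !unit_base_nodeS// => /node_inj[||stE uv].
  + exact: initseg_all (unit_base_initseg Ou) un.
  + exact: initseg_all (unit_base_initseg Ov) vn.
  rewrite -{t}stE in Mt *; have [th2O _ _ _ _] := th2 s Ms.
  have [tun tu0] := low _ _ (th2O _ Ou); have [tvn tv0] := low _ _ (th2O _ Ov).
  have [_ us] := um s Ms.
  by rewrite !node_thetaS// !unit_base_nodeS// (us u v).
Qed.

(** The assertion of the theorem for [OmegaN n], with levels counted from [0]. *)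
Definition good_mapN n f (delta : R) (a : nat -> R) theta e : Prop :=
  [/\ xprune leD (OmegaN n) (OmegaN n) theta e, unit_map n theta,
      forall s t, OmegaN n s -> MAX (OmegaN n) t -> initseg s t ->
        a (level xi n s) - delta <= f (theta s) (e t)
    & forall i t, (i < n)%N -> MAX (OmegaN n) t ->
        lsum xi n i (fun s => prob xi (top_block xi n s) * f s (e t)) (e t)
          <= a i + delta].

Definition goodN n : Prop := forall delta f, 0 < delta -> bounded_on (OmegaN n) f ->
  exists theta e a, good_mapN n f delta a theta e /\ forall i, -1 <= a i <= 1.

Lemma good_mapN_comp n f delta a theta e theta' e' :
  good_mapN n f delta a theta e -> xprune leD (OmegaN n) (OmegaN n) theta' e' ->
  unit_map n theta' -> good_mapN n f delta a (theta \o theta') (e \o e').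
Proof.
move=> [th um lo up] th' um'; have [thO _ _ eM te'] := th'.
split; [exact: xprune_comp th'|exact: unit_map_comp| |by move=> i t i_n /eM/up; apply].
move=> s t Os Mt st /=; have [l _] := um'; rewrite -(l s Os); apply: lo.
- exact: thO.
- exact: eM.
- exact: initseg_trans (xprune_le th' Os (MAX_in Mt) st) (te' _ Mt).
Qed.

Lemma first_level_ex n t : MAX (OmegaN n.+1) t ->
  exists s, [/\ OmegaN n.+1 s, initseg s t & level xi n.+1 s = 0%N].
Proof.
case: n => [|n] Mt.
  exists t; split; [exact: MAX_in|exact: initseg_refl|].
  by have := level_lt D_inh (MAX_in Mt); case: level.
have [s [u [-> Ms _]]] := MAX_nodeP D_inh Mt.
exists (node xi n.+1 s [::]); split; last exact: level_node0.
  by apply: OmegaN_node0 => //; exact: MAX_in.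
exact/initseg_node0/initseg_refl.
Qed.

(** For a map that ignores its first argument, level 0 alone decides: every maximal node has an
    initial segment there, and that level has total weight 1. *)
Lemma goodN_stabilize n : goodN n.+1 ->
  forall (J : eqType) (l : seq J) (h : J -> seq (Ord * D) -> R) eta, 0 < eta ->
  (forall j t, j \in l -> MAX (OmegaN n.+1) t -> -1 <= h j t <= 1) ->
  exists theta e (b : J -> R),
    [/\ xprune leD (OmegaN n.+1) (OmegaN n.+1) theta e, unit_map n.+1 theta,
        forall j, -1 <= b j <= 1
      & forall j t, j \in l -> MAX (OmegaN n.+1) t -> `|h j (e t) - b j| <= eta].
Proof.
move=> gN; apply: stabilize_seq => //.
  by move=> theta theta'; exact: unit_map_comp.
move=> h eta eta0 h1.
have [|theta [e [a [[th um lo up] a1]]]] := gN eta (fun _ t => h t) eta0.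
  by move=> s t [_ _ /= Mt]; exact: h1.
have [_ _ _ eM _] := th.
exists theta, e, (a 0%N); split=> // t Mt.
have [s [Os st s0]] := first_level_ex Mt.
rewrite ler_norml; apply/andP; split.
  by rewrite lerBrDr addrC -s0; exact: lo st.
move: (up 0%N _ isT Mt); rewrite /lsum isum_mulr -/(lsum _ _ _ _ _).
rewrite lsum_prob//; first by rewrite mul1r lerBlDl addrC.
  by move=> ?; exact: isum_prob.
exact: eM.
Qed.

End LevelInduction.

(** * Induction on the number of levels *)

Section LevelStep.
Variables (R : realType) (D : Type) (leD : D -> D -> Prop).
Hypothesis dirD : directed_set leD.
Variable xi : Ord.
Hypothesis good_xi : good leD (Omega xi) (prob xi : _ -> R).
Implicit Types (s t u v w : seq (Ord * D)) (n m i : nat).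
Implicit Types (theta e : seq (Ord * D) -> seq (Ord * D)).
Implicit Types (f : seq (Ord * D) -> seq (Ord * D) -> R).

Let D_inh : inhabited D. Proof. by case: dirD. Qed.

Local Notation OmegaN := (@OmegaN D xi).
Local Notation Omega := (@Omega D xi).

Lemma goodN1 : goodN R leD xi 1.
Proof.
move=> delta f delta0 fb; have [theta [e [a [[th lo up] a1]]]] := good_xi delta0 fb.
exists theta, e, (fun=> a); split=> //; split=> //.
- split=> [s _|s t _ _ _]; first by rewrite !level1.
  by rewrite -[theta s](node0n xi) -[theta t](node0n xi) !unit_base_node0.
- move=> i t; rewrite ltnS leqn0 => /eqP-> Mt; apply: le_trans (up t Mt).
  rewrite -[X in lsum _ _ _ _ X](node0n xi) lsum0// le_eqVlt; apply/orP; left.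
  by apply/eqP/eq_isum => // s _ _; rewrite top_block_node0 node0n.
Qed.

(** Above each maximal node [t] of the first level, the induction hypothesis
    applies; stabilizing also makes the values at the nodes of the first level
    below [t] almost independent of the continuation of [t]. *)
Lemma good_above n delta f t : goodN R leD xi n.+1 -> 0 < delta ->
  bounded_on (OmegaN n.+2) f -> MAX Omega t ->
  exists theta e a g, [/\
    good_mapN leD xi n.+1 (fun u v => f (node xi n.+1 t u) (node xi n.+1 t v))
      delta a theta e,
    forall i, -1 <= a i <= 1, forall s, -1 <= g s <= 1
  & forall s v, Omega s -> initseg s t -> MAX (OmegaN n.+1) v ->
      `|f (node xi n.+1 s [::]) (node xi n.+1 t (e v)) - g s| <= delta].
Proof.
move=> gN delta0 fb Mt.
have fb' : bounded_on (OmegaN n.+1)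
    (fun u v => f (node xi n.+1 t u) (node xi n.+1 t v)).
  move=> u v [/= Ou uv Mv]; apply: fb; split=> /=.
  - exact: OmegaN_node.
  - exact/initseg_catl.
  - exact: MAX_node.
have [theta [e [a [G a1]]]] := gN _ _ delta0 fb'; have [[_ _ _ eM _] _ _ _] := G.
(* The first-level nodes below [t] are indexed by their length, which gives a finite list; lengths
   that yield no node get the value 0. *)
pose h k v := if `[< Omega (take k t) >] then
  f (node xi n.+1 (take k t) [::]) (node xi n.+1 t (e v)) else 0.
have [|theta' [e' [b [th' um' b1 hb]]]] :=
  goodN_stabilize dirD gN (l := iota 0 (size t).+1) (h := h) delta0.
  move=> k v _ Mv; rewrite /h; case: asboolP => Ok; last by rewrite lerN10 ler01.
  apply: fb; split=> /=; first exact: OmegaN_node0.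
    exact/initseg_node0/initseg_take.
  exact/MAX_node/eM.
exists (theta \o theta'), (e \o e'), a, (fun s => b (size s)); split=> //.
  exact: good_mapN_comp.
move=> s v Os st Mv.
have := hb (size s) v; rewrite mem_iota add0n ltnS initseg_size// => /(_ isT Mv).
by rewrite /h -(initseg_takeE st) asboolT.
Qed.

Lemma goodN_step n : goodN R leD xi n.+1 -> goodN R leD xi n.+2.
Proof.
move=> gN delta f delta0 fb.
have d4 : 0 < delta / 4 by rewrite divr_gt0.
have d2 : 0 < delta / 2 by rewrite divr_gt0.
have /choice[th2 /choice[es /choice[A /choice[g H]]]] t : exists theta e a g, MAX Omega t ->
    [/\ good_mapN leD xi n.+1 (fun u v => f (node xi n.+1 t u) (node xi n.+1 t v))
      (delta / 4) a theta e,
    forall i, -1 <= a i <= 1, forall s, -1 <= g s <= 1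
  & forall s v, Omega s -> initseg s t -> MAX (OmegaN n.+1) v ->
      `|f (node xi n.+1 s [::]) (node xi n.+1 t (e v)) - g s| <= delta / 4].
  have [Mt|] := pselect (MAX Omega t); last by exists id, id, (fun=> 0), (fun=> 0).
  by have [theta [e [a [g H]]]] := good_above gN d4 fb Mt; exists theta, e, a, g.
(* Up to [delta / 4], after the pruning above [t], the value of [f] at a first-level node [s]
   depends only on [s] and the first block [t], and equals [g t s]. *)
have [|theta1 [e1 [a1 [G1 a1b]]]] := good_xi (f := fun s t => g t s) d4.
  by move=> s t [_ _ /= Mt]; have [_ _ + _] := H t Mt; apply.
have [[_ _ _ e1M _] _ _] := G1.
(* The constants needed are those above [e1 t], the image of the first block; precomposition then
   preserves the bounds in [G1]. *)
have [|theta1' [e1' [b [th1' bb hb]]]] := good_stabilize dirD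
    (@isum_prob R D D_inh xi) good_xi (l := iota 0 n.+1)
    (h := fun i t => A (e1 t) i) d2.
  by move=> i t _ Mt; have [_ + _ _] := H _ (e1M _ Mt); apply.
have [th lo up] := good_map_comp dirD G1 th1'.
have [thO _ _ eM te] := th; have [_ _ _ e1M' _] := th1'.
move: hb th lo up thO eM te.
set Th := theta1 \o theta1'; set E := e1 \o e1' => hb th lo up thO eM te.
have {}hb i t : (i < n.+1)%N -> MAX Omega t -> `|A (E t) i - b i| <= delta / 2.
  by move=> i_n Mt; apply: hb => //; rewrite mem_iota.
have H2 t Mt := H _ (eM t Mt).
have xp2 t : MAX Omega t -> xprune leD (OmegaN n.+1) (OmegaN n.+1) (th2 (E t)) (es (E t)).
  by move=> /H2[[]].
exists (node_theta xi n.+1 n.+1 Th E (th2 \o E)), (node_e xi n.+1 n.+1 E (es \o E)).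
(* Level 0 loses [delta / 4] in the single-level case and [delta / 4] in passing from [f] to [g]; a
   higher level loses [delta / 4] above the first block and [delta / 2] in stabilizing its
   constant. *)
exists (fun i => if i is j.+1 then b j else a1); split; last by case.
split.
- exact: xprune_node.
- by apply: (unit_map_node dirD th xp2) => t /H2[[]].
- move=> s _ Os /(MAX_nodeP D_inh)[t [v [-> Mt Mv]]] st.
  have [vn v0] := OmegaN_below (MAX_in Mv); rewrite (node_eE _ _ _ _ vn)//.
  have [[_ _ lo2 _] _ _ hg] := H2 t Mt.
  move: Os st => /(OmegaN_S D_inh)[s0 [u [-> [[-> Os0]|[Ms0 Ou]]]]].
    move=> /initseg_node[//|//|st _]; rewrite node_theta0 level_node0.
    have Tst : initseg (Th s0) (E t).
      exact: initseg_trans (xprune_le th Os0 (MAX_in Mt) st) (te _ Mt).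
    have := hg _ v (thO _ Os0) Tst Mv.
    by have := lo s0 t Os0 Mt st; rewrite ler_norml => + /andP[+ _]; lra.
  have [un u0] := OmegaN_below Ou.
  move=> /initseg_node[//|//|st uv].
  have stE := MAX_initseg Ms0 (MAX_in Mt) st; rewrite stE node_thetaS// level_nodeS//.
  have := hb _ t (level_lt D_inh Ou) Mt; have := lo2 u v Ou Mv uv.
  by rewrite ler_norml /= => + /andP[+ _]; lra.
- move=> i _ i_n /(MAX_nodeP D_inh)[t [v [-> Mt Mv]]].
  have [vn v0] := OmegaN_below (MAX_in Mv); rewrite (node_eE _ _ _ _ vn)//=.
  have [[[_ _ _ es2 _] _ _ up2] _ _ hg] := H2 t Mt.
  have [wn w0] := OmegaN_below (MAX_in (es2 v Mv)).
  case: i i_n => [_|i i_n]; last first.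
    rewrite lsumS//; last exact: eM.
    have := hb i t i_n Mt; have := up2 i v i_n Mv.
    rewrite ler_norml => + /andP[_ +].
    rewrite /lsum (eq_isum (Q' := fun s => OmegaN n.+1 s /\ level xi n.+1 s = i)
      (G' := fun u => prob xi (top_block xi n.+2 (node xi n.+1 (E t) u)) *
        f (node xi n.+1 (E t) u) (node xi n.+1 (E t) (es (E t) v))))//; last first.
      by move=> u _ [/OmegaN_below[un u0] _]; rewrite top_block_nodeS.
    by lra.
  rewrite lsum0//.
  have := up t Mt; have P1 := @isum_prob R D D_inh xi _ (eM t Mt).
  (* Replacing [f] by [g] costs at most [delta / 4] in all, since the weights are nonnegative and
     add up to 1. *)
  have : isum Omega (fun s => prob xi (top_block xi n.+2 (node xi n.+1 s [::])) *
      f (node xi n.+1 s [::]) (node xi n.+1 (E t) (es (E t) v))) (E t) <=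
      isum Omega (fun s => prob xi s * g (E t) s + prob xi s * (delta / 4)) (E t).
    apply: ler_isum => s st Os; rewrite top_block_node0 -mulrDr.
    apply: ler_wpM2l; first exact: prob_ge0.
    have := hg s v Os st Mv; rewrite ler_norml => /andP[_]; lra.
  by rewrite isumD isum_mulr P1; lra.
Qed.

Lemma goodN_good n : goodN R leD xi n.+1.
Proof. by elim: n => [|n /goodN_step]; [exact: goodN1|]. Qed.

End LevelStep.

(** * Counting the terms that are not far below the mean *)

Lemma mean_bounds (R : realType) (a : nat -> R) (N : nat) (m : R) :
  (forall i, -1 <= a i <= 1) -> \sum_(i < N.+1) a i = N.+1%:R * m -> -1 <= m <= 1.
Proof.
move=> a1 mE; have N0 : 0 < N.+1%:R :> R by rewrite ltr0n.
have sumc (c : R) : \sum_(i < N.+1) c = N.+1%:R * c.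
  by rewrite sumr_const card_ord mulr_natl.
apply/andP; split; rewrite -(ler_pM2l N0) -mE -sumc; apply: ler_sum => i _.
  by have /andP[] := a1 i.
by have /andP[] := a1 i.
Qed.

(** Markov's inequality: a counted term exceeds [m - eta] by at most [1 - m + eta <= 2 + eta], the
    others do not exceed it. Summing, [(N + 1) * eta] is at most [2 + eta] times the count. *)
Lemma count_above_mean (R : realType) (a : nat -> R) (N k : nat) (m eta : R) :
  (forall i, -1 <= a i <= 1) -> \sum_(i < N.+1) a i = N.+1%:R * m -> 0 < eta ->
  k%:R * (2 + eta) <= N.+1%:R * eta ->
  (k <= count (fun i => (m - eta <= a i)%R) (iota 0 N.+1))%N.
Proof.
move=> a1 mE eta0 kN; set p := fun i => _; set c := count _ _.
have /andP[m1 _] := mean_bounds a1 mE.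
have : \sum_(i < N.+1) a i <= N.+1%:R * (m - eta) + c%:R * (1 - m + eta).
  have -> : c%:R * (1 - m + eta) = \sum_(i < N.+1) (p i)%:R * (1 - m + eta).
    rewrite -mulr_suml; congr (_ * _); rewrite /c -sum1_count natr_sum big_mkcond.
    rewrite -[iota 0 N.+1]/(index_iota 0 N.+1) big_mkord; apply: eq_bigr => i _.
    by case: (p i).
  rewrite [X in X%:R * _](_ : _ = \sum_(i < N.+1) 1)%N; last by rewrite sum1_card card_ord.
  rewrite natr_sum mulr_suml -big_split; apply: ler_sum => i _ /=.
  have /andP[_ ai1] := a1 i; rewrite mul1r; case: (boolP (p i)) => pi.
    by rewrite mul1r; lra.
  by move: pi; rewrite /p -ltNge mul0r addr0 => /ltW.
rewrite mE => h; rewrite leqNgt; apply/negP => ck.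
have : c.+1%:R * (2 + eta) <= k%:R * (2 + eta) by rewrite ler_wpM2r ?ler_nat//; lra.
have : c%:R * (1 - m + eta) <= c%:R * (2 + eta) by rewrite ler_wpM2l//; lra.
by rewrite -natr1; lra.
Qed.

(** * Induction on the ordinal for a single level *)

Section OrdinalInduction.
Variables (R : realType) (D : Type) (leD : D -> D -> Prop).
Hypothesis dirD : directed_set leD.
Implicit Types (s t u v w : seq (Ord * D)) (n m i : nat) (xi z : Ord).
Implicit Types (theta e : seq (Ord * D) -> seq (Ord * D)).
Implicit Types (f : seq (Ord * D) -> seq (Ord * D) -> R).

Let D_inh : inhabited D. Proof. by case: dirD. Qed.

(** The target levels are scanned upwards: one satisfying [p] receives the next source level, any
    other is skipped. All nodes thus land on selected levels, where [good_succ] has its lower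
    bound. *)
Lemma xprune_select xi n N (p : pred nat) :
  (n.+1 <= count p (iota 0 N.+1))%N ->
  exists theta e, xprune leD (OmegaN xi n.+1) (OmegaN xi N.+1) theta e /\
    forall s, OmegaN xi n.+1 s -> p (level xi N.+1 (theta s)).
Proof.
have [w Mw] := @MAX_Omega_ex D D_inh xi.
elim: N n p => [|N IH] n p.
  have -> : count p (iota 0 1) = p 0%N by rewrite /= addn0.
  case: n => [p0|n]; last by case: (p 0%N).
  exists id, id; split; first exact: xprune_id.
  by move=> s _; rewrite level1; case: (p 0%N) p0.
have -> : count p (iota 0 N.+2) = (p 0%N + count (p \o S) (iota 0 N.+1))%N.
  rewrite -[N.+2]add1n iotaD count_cat; congr addn; first exact: addn0.
  by rewrite -[(0 + 1)%N]/(1 + 0)%N iotaDl count_map; apply: eq_count.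
(* A skipped level is crossed by the fixed maximal block [w]. *)
case: (boolP (p 0%N)) => p0; last first.
  rewrite add0n => /IH[theta [e [th thp]]]; have [thO thl lab eM te] := th.
  exists (fun t => node xi N.+1 w (theta t)), (fun t => node xi N.+1 w (e t)).
  have low s : OmegaN xi n.+1 s -> below xi N.+1 (theta s) /\ theta s <> [::].
    by move=> /thO/OmegaN_below.
  split=> [|s Os]; last by have [sn s0] := low _ Os; rewrite level_nodeS//; exact: thp.
  split=> [s Os|s t Os Ot st|s Os|t Mt|t Mt].
  - by apply: OmegaN_node => //; exact: thO.
  - exact/pinitseg_catl/thl.
  - by apply: label_le_cat; [have [] := low _ Os|exact: lab].
  - by apply: MAX_node => //; exact: eM.
  - exact/initseg_catl/te.
rewrite add1n ltnS; case: n => [_|n /IH[theta [e [th thp]]]].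
  (* The last source level is placed here; [e] appends [v] to reach a maximal node of the taller
     tree. *)
  have [v Mv] := @MAX_OmegaN_ex D D_inh xi N.
  exists (fun t => node xi N.+1 t [::]), (fun t => node xi N.+1 t v).
  split=> [|s _]; last by rewrite level_node0.
  split=> [s Os|s t Os Ot st|s Os|t Mt|t Mt].
  - exact: OmegaN_node0.
  - by rewrite /node !cats0; exact: pinitseg_oshiftD.
  - by rewrite /node cats0 => U; rewrite label_oshiftD; exact: label_le_refl.
  - exact: MAX_node.
  - exact/initseg_node0/initseg_refl.
exists (node_theta xi n.+1 N.+1 id id (fun=> theta)), (node_e xi n.+1 N.+1 id (fun=> e)).
split; first by apply: (xprune_node dirD) => //; exact: xprune_id.
have [thO _ _ _ _] := th.
move=> _ /(OmegaN_S D_inh)[t [u [-> [[-> Ot]|[Mt Ou]]]]].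
  by rewrite node_theta0 level_node0.
have [un u0] := OmegaN_below Ou; have [vn v0] := OmegaN_below (thO _ Ou).
by rewrite node_thetaS// level_nodeS//; exact: thp.
Qed.

Lemma good_zero : good leD (Omega ozero) (prob ozero : seq (Ord * D) -> R).
Proof.
move=> delta f delta0 fb; pose x (U : D) := [:: (ozero, U)].
have [_ refl trans dir] := dirD.
have Mx U : MAX (Omega ozero) (x U).
  by split; [exact: Omega0E|move=> t /Omega0P[V ->] [[|//] [->]]].
have [|a a1 /choice[phi phiP]] :=
    cofinal_cluster (h := fun U => f (x U) (x U)) D_inh trans dir _ delta0.
  move=> U; apply: fb; split; [exact: Omega0E|exact: initseg_refl|exact: Mx].
(* Labels move up to [phi U], where [f] is within [delta] of the cluster value. *)
pose th t := [seq (y.1, phi y.2) | y <- t].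
exists th, th, a; split=> //; split.
- split=> [_ /Omega0P[U ->]|_ _ /Omega0P[U ->] /Omega0P[V ->]|_ /Omega0P[U ->]|t|t].
  + exact: Omega0E.
  + by move=> [[[|//] [->]] []].
  + by move=> _ [<-]; exists (phi U) => //; have [] := phiP U.
  + by move=> /MAX_in/Omega0P[U ->]; exact: Mx.
  + by move=> _; exact: initseg_refl.
- move=> _ _ /Omega0P[U ->] /MAX_in/Omega0P[V ->] [[|//] [->]].
  by have [_] := phiP U; rewrite ler_norml => /andP[+ _]; rewrite /x /=; lra.
- move=> _ /MAX_in/Omega0P[U ->]; rewrite /isum /initsegs /= !big_cons big_nil.
  rewrite asboolF; last by move=> /Omega0P[].
  rewrite asboolT ?prob0 ?addr0 ?mul1r; last exact: Omega0E.
  by have [_] := phiP U; rewrite ler_norml => /andP[_]; rewrite /x; lra.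
Qed.

Lemma good_succ xi : good leD (Omega xi) (prob xi : seq (Ord * D) -> R) ->
  good leD (Omega (osucc xi)) (prob (osucc xi) : seq (Ord * D) -> R).
Proof.
move=> g; have gN := goodN_good dirD g; rewrite Omega_succ.
apply: good_union => [i j s t|delta f delta0 fb]; first exact: OmegaN_disj.
have d4 : 0 < delta / 4 by rewrite divr_gt0.
have /choice[th /choice[e /choice[A H]]] N : exists theta e a,
    good_mapN leD xi N.+1 f (delta / 4) a theta e /\ forall i, -1 <= a i <= 1.
  apply: gN => // s t [/= Os st Mt]; apply: fb; split=> //=; first by exists N.
  by apply/MAX_union; [move=> i j ? ?; exact: OmegaN_disj|exists N].
pose m N := N.+1%:R^-1 * \sum_(i < N.+1) A N i.
have N0 N : 0 < N.+1%:R :> R by rewrite ltr0n.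
have mE N : N.+1%:R * m N = \sum_(i < N.+1) A N i.
  by rewrite mulrA divff ?mul1r// gt_eqF.
have m1 N : -1 <= m N <= 1.
  by have [_ A1] := H N; exact: mean_bounds A1 (esym (mE N)).
have [||a a1 aP] := @cofinal_cluster R nat leq m (delta / 4) (inhabits 0%N) _ _ m1 d4.
- by move=> x y z; exact: leq_trans.
- by move=> x y; exists (maxn x y); rewrite leq_maxl leq_maxr.
exists a => // n.
(* This [k] makes [count_above_mean] give at least [n + 1] levels for every [N >= k]. *)
have [k kP] := archi_nat (n.+1%:R * (2 + delta / 4) / (delta / 4)).
have [N [kN]] := aP k; rewrite ler_norml => /andP[aN Na].
have [[th_p um lo up] A1] := H N; have [_ _ _ eM _] := th_p.
(* The lower bound loses [delta / 4] three times: from [f] to [A N i], from [A N i] to the mean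
   [m N], and from the mean to [a]. *)
have [|sigma [sigma' [sg sgp]]] := @xprune_select xi n N (fun i => m N - delta / 4 <= A N i).
  apply: count_above_mean => //; apply: le_trans (_ : k%:R * (delta / 4) <= _).
    by rewrite -ler_pdivrMr.
  by apply: ler_wpM2r; [exact: ltW|rewrite ler_nat ltnW].
have [sgO _ _ sgM sgte] := sg.
exists N, (th N \o sigma), (e N \o sigma'); split; first exact: xprune_comp sg.
  move=> s t Os Mt st.
  have := lo (sigma s) (sigma' t) (sgO _ Os) (sgM _ Mt).
  move=> /(_ (initseg_trans (xprune_le sg Os (MAX_in Mt) st) (sgte _ Mt))) /=.
  by have := sgp s Os; lra.
move=> t /sgM Mt /=.
(* The weight at [osucc xi] carries the factor 1 / (N + 1), so the branch sum is the mean of the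
   level sums and is at most [m N + delta / 4]. *)
rewrite (eq_isum (Q' := OmegaN xi N.+1) (G' := fun s => N.+1%:R^-1 *
  (prob xi (top_block xi N.+1 s) * f s (e N (sigma' t)))))//; last first.
  by move=> s _ Os; rewrite (prob_top R D_inh Os) mulrA.
rewrite isum_mull (isum_lsum D_inh) ler_pdivrMl//.
apply: le_trans (_ : \sum_(i < N.+1) (A N i + delta / 4) <= _).
  by apply: ler_sum => i _; exact: up.
rewrite big_split /= -mE sumr_const card_ord -[(delta / 4) *+ _]mulr_natl -mulrDr ler_pM2l//.
by lra.
Qed.

Lemma good_lim xi : olimit xi ->
  (forall z, (z < xi)%O -> good leD (Omega z) (prob z : seq (Ord * D) -> R)) ->
  good leD (Omega xi) (prob xi : seq (Ord * D) -> R).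
Proof.
move=> lx IH; have [/eqP xi0 succ_lt] := lx; rewrite Omega_lim//.
apply: good_union => [i j s t|delta f delta0 fb]; first exact: Omega_lim_disj.
have d2 : 0 < delta / 2 by rewrite divr_gt0.
pose I := {z | (z < xi)%O}; pose sh (i : I) := @oshiftD D (opow (sval i)).
(* The induction hypothesis is used at the successor of each [z < xi], still below the limit, for
   [f] pulled back along the shift. *)
have /choice[th /choice[e /choice[A H]]] (i : I) : exists theta e a,
    good_map leD (Omega (osucc (sval i))) (Omega (osucc (sval i)))
      (prob (osucc (sval i))) (fun s t => f (sh i s) (sh i t)) (delta / 2) a theta e
    /\ -1 <= a <= 1.
  apply: (IH _ (succ_lt _ (svalP i))) => // s t [/= Os st Mt]; apply: fb; split=> /=.
  - by exists i => //; exists s.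
  - exact/initseg_oshiftD.
  - apply/MAX_union; first by move=> j k ? ?; exact: Omega_lim_disj.
    by exists i; apply/MAX_image_oshiftD.
have i0 : inhabited I.
  by constructor; exists ozero; rewrite lt_neqAle eq_sym xi0 ozero_le.
have [||||a a1 aP] := @cofinal_cluster R I (fun i j : I => (sval i <= sval j)%O) A
    (delta / 2) i0.
- by move=> i j k; exact: le_trans.
- move=> i j; case: (leP (sval i) (sval j)) => ij; [exists j|exists i]; split=> //.
  exact: ltW.
- by move=> i; have [] := H i.
- exact: d2.
exists a => // i; have [j [ij]] := aP i; rewrite ler_norml => /andP[aj ja].
have [G _] := H j.
(* The summand of [i] is sent into that of [j]: unshift, embed into the larger tree, prune there,
   shift back. *)
have [|c [cO cM]] := @Omega_embed D (osucc (sval i)) (osucc (sval j)).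
  by rewrite osucc_le lt_osuccE.
have := good_map_comp dirD G (xprune_comp dirD
  (xprune_oshiftD dirD cO cM) (xprune_unshift dirD (Omega (osucc (sval i))) (opow (sval i)))).
set th' := th j \o _; set e' := e j \o _ => -[th'_p lo' up'].
have [_ _ _ eM' _] := th'_p.
exists j, (sh j \o th'), (sh j \o e'); split.
- apply: (xprune_comp dirD) th'_p; apply: (xprune_oshiftD dirD) => [s Os|s Ms].
    by exists s.
  exact/MAX_image_oshiftD.
- by move=> s t Os Mt st; have := lo' s t Os Mt st; rewrite /=; lra.
- move=> t Mt; rewrite /= isum_map; have := up' t Mt.
  rewrite (eq_isum (Q' := Omega (osucc (sval j)))
    (G' := fun s => prob (osucc (sval j)) s * f (sh j s) (sh j (e' t)))) => [||s _].
  + by lra.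
  + move=> s _; split=> [[u Ou /oshiftD_inj <-]//|Os]; by exists s.
  + by move=> [u Ou /oshiftD_inj <-]; rewrite prob_lim//; exact: (svalP j).
Qed.

Lemma good_all xi : good leD (Omega xi) (prob xi : seq (Ord * D) -> R).
Proof.
elim/ord_ind: xi => xi IH; have [->|[z xz]|lx] := Ord_cases xi.
- exact: good_zero.
- by rewrite xz; apply: good_succ; apply: IH; rewrite xz lt_osucc.
- exact: good_lim.
Qed.

End OrdinalInduction.

(** * Units in terms of unit bases *)

Section Units.
Variables (D : Type) (leD : D -> D -> Prop).
Hypothesis dirD : directed_set leD.
Variable xi : Ord.
Implicit Types (s t u : seq (Ord * D)) (n m i : nat).

Let D_inh : inhabited D. Proof. by case: dirD. Qed.

Lemma level0_unit_base n t : OmegaN xi n t -> level xi n t = 0%N ->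
  unit_base xi n t = [::].
Proof.
case: n => // n /(OmegaN_S D_inh)[s [u [-> [[-> _]|[_ Ou]]]]].
  by rewrite unit_base_node0.
by have [un u0] := OmegaN_below Ou; rewrite level_nodeS.
Qed.

(** All blocks but the last are complete, so removing the last one leaves a maximal node of the
    preceding level. That level is [Lambda xi n i.+1], since [Lambda] counts from 1. *)
Lemma MAX_unit_base n i t : OmegaN xi n t -> level xi n t = i.+1 ->
  MAX (Lambda xi n i.+1) (unit_base xi n t).
Proof.
elim: n i t => // n IH i _ /(OmegaN_S D_inh)[s [u [-> [[-> _]|[Ms Ou]]]]].
  by rewrite level_node0.
have [un u0] := OmegaN_below Ou; rewrite level_nodeS// unit_base_nodeS// => -[ui].
case: i ui => [ui|i ui].
  rewrite level0_unit_base//; split.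
    apply/(LambdaE D_inh); rewrite level_node0; split=> //.
    by apply: OmegaN_node0 => //; exact: MAX_in.
  move=> _ /(LambdaE D_inh)[/(OmegaN_S D_inh)[t [v [-> [[-> Ot]|[_ Ov]]]]]].
    by move=> _ /initseg_node[//|//|st _]; rewrite (MAX_initseg Ms Ot st).
  by have [vn v0] := OmegaN_below Ov; rewrite level_nodeS.
have [/(LambdaE D_inh)[Ob bi] m] := IH i u Ou ui.
have [bn b0] := OmegaN_below Ob; split.
  by apply/(LambdaE D_inh); rewrite level_nodeS// bi; split=> //; exact: OmegaN_node.
move=> _ /(LambdaE D_inh)[/(OmegaN_S D_inh)[t [v [-> [[-> Ot]|[Mt Ov]]]]]].
  by rewrite level_node0.
have [vn v0] := OmegaN_below Ov; rewrite level_nodeS// => -[vi].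
move=> /initseg_node[//|//|st bv]; rewrite (MAX_initseg Ms (MAX_in Mt) st).
by rewrite (m v)//; apply/(LambdaE D_inh).
Qed.

Lemma pinitseg_unit_base n i t : OmegaN xi n t -> level xi n t = i.+1 ->
  pinitseg (unit_base xi n t) t.
Proof.
move=> Ot ti; split; first exact: (unit_base_initseg dirD).
have /MAX_in/(LambdaE D_inh)[_ +] := MAX_unit_base Ot ti.
by move=> + e; rewrite e ti => /esym/n_Sn.
Qed.

(** Both [s] and the base are maximal on the same level and lie below [t]; being comparable, they
    coincide. *)
Lemma unit_base_eq n i s t : MAX (Lambda xi n i.+1) s -> pinitseg s t ->
  Lambda xi n i.+2 t -> unit_base xi n t = s.
Proof.
move=> Ms [st _] /(LambdaE D_inh)[Ot ti]; have Mb := MAX_unit_base Ot ti.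
have [bt _] := pinitseg_unit_base Ot ti.
have [sb|bs] := initseg_comparable st bt.
  by rewrite (MAX_initseg Ms (MAX_in Mb) sb).
exact: MAX_initseg Mb (MAX_in Ms) bs.
Qed.

Lemma unit_map_preserving n theta e : xprune leD (OmegaN xi n) (OmegaN xi n) theta e ->
  unit_map xi n theta -> unit_preserving leD xi n theta e.
Proof.
move=> th [lt ut]; have [thO _ _ _ _] := th.
split; [exact: xprune_ext| |].
  move=> V [->|[[|m] [s [+ Ms VE]]]] // => [|m_n].
    exists (Lambda xi n 1); first by left.
    move=> _ [s /(LambdaE D_inh)[Os s0] <-]; apply/(LambdaE D_inh).
    by rewrite lt//; split=> //; exact: thO.
  (* The target unit is built from a member of [V]; should there be none, the first unit serves. *)
  have [[t Vt]|nV] := pselect (exists t, V t); last first.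
    exists (Lambda xi n 1); first by left.
    by move=> _ [t Vt <-]; case: nV; exists t.
  have VP u : V u -> [/\ OmegaN xi n u, level xi n u = m.+1 & unit_base xi n u = s].
    rewrite VE => -[su Lu]; have /(LambdaE D_inh)[Ou ui] := Lu.
    by split=> //; exact: unit_base_eq su Lu.
  have [Ot ti tb] := VP t Vt.
  (* All members of [V] have base [s], so their images share the base of [theta t], which determines
     the target unit. *)
  have Mb : MAX (Lambda xi n m.+1) (unit_base xi n (theta t)).
    by apply: MAX_unit_base; [exact: thO|rewrite lt].
  exists [set u | pinitseg (unit_base xi n (theta t)) u /\ Lambda xi n m.+2 u].
    by right; exists m.+1, (unit_base xi n (theta t)).
  move=> _ [u /VP[Ou ui ub] <-]; split; last first.
    by apply/(LambdaE D_inh); rewrite lt//; split=> //; exact: thO.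
  rewrite (ut t u)//; last by rewrite tb ub.
  by apply: (@pinitseg_unit_base _ m); [exact: thO|rewrite lt].
(* [theta] keeps every level, so images on one level come from one level. [Lambda xi n 0] is empty
   because a list of blocks is not. *)
move=> s t Os Ot _ nst [[|m] [Ls Lt]].
  by have [_ [ts [/andP[+ _] _ _ _] /eqP ts0]] := Ls; case: ts ts0.
apply: nst; exists (level xi n s).+1; split; apply/(LambdaE D_inh); split=> //.
have [_ sm] := (LambdaE D_inh _ _ _ _).1 Ls; have [_ tm] := (LambdaE D_inh _ _ _ _).1 Lt.
by rewrite -(lt s Os) -(lt t Ot) sm tm.
Qed.

End Units.

Theorem theorem3p1 (R : realType) (D : Type) (leD : D -> D -> Prop)
    (dirD : directed_set leD) (xi : Ord) (n : nat) (n_gt0 : (0 < n)%N)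
    (delta : R) (delta01 : 0 < delta < 1)
    (f : seq (Ord * D) -> seq (Ord * D) -> R)
    (f_bound : forall s t, PiS (OmegaN xi n) (s, t) -> -1 <= f s t <= 1) :
  exists (theta e : seq (Ord * D) -> seq (Ord * D)) (a : 'I_n -> R),
    [/\ unit_preserving leD xi n theta e,
        forall i : 'I_n, -1 <= a i <= 1,
        forall (i : 'I_n) (s t : seq (Ord * D)),
          Lambda xi n i.+1 s -> MAX (OmegaN xi n) t -> initseg s t ->
          a i - delta <= f (theta s) (e t),
        forall (i : 'I_n) (t : seq (Ord * D)), MAX (OmegaN xi n) t ->
          \sum_(s <- initsegs (e t) | `[< Lambda xi n i.+1 s >])
            prob xi (last_block xi n s) * f s (e t) <= delta / n%:R + a i
      & forall t : seq (Ord * D), MAX (OmegaN xi n) t ->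
          \sum_(s <- initsegs (e t) | `[< OmegaN xi n s >])
            prob xi (last_block xi n s) * f s (e t) <= delta + \sum_i a i].
Proof.
case: n n_gt0 f_bound => // n _ f_bound.
have D_inh : inhabited D by case: dirD.
have /andP[delta0 _] := delta01.
have N0 : 0 < n.+1%:R :> R by rewrite ltr0n.
have dN0 : 0 < delta / n.+1%:R by rewrite divr_gt0.
have dN : delta / n.+1%:R <= delta.
  by rewrite ler_pdivrMr// ler_peMr ?ler1n// ltW.
(* The tolerance [delta / n.+1%:R] is the one in (ii); it is at most [delta], as (i) requires, and
   adds up to [delta] over the [n + 1] levels. *)
have [theta [e [a [[th um lo up] a1]]]] :=
  goodN_good dirD (@good_all R D leD dirD xi) (n := n) dN0 f_bound.
have [_ _ _ eM _] := th.
have upE G t : MAX (OmegaN xi n.+1) t ->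
    (forall i : 'I_n.+1, isum (Lambda xi n.+1 i.+1) G (e t) = lsum xi n.+1 i G (e t)).
  by move=> Mt i; apply: eq_isum => // s _; exact: LambdaE.
have lastE (Q : set (seq (Ord * D))) t : Q `<=` OmegaN xi n.+1 ->
    isum Q (fun s => prob xi (last_block xi n.+1 s) * f s (e t)) (e t) =
    isum Q (fun s => prob xi (top_block xi n.+1 s) * f s (e t)) (e t).
  by move=> QO; apply: eq_isum => // s _ /QO Os; rewrite last_block_top.
exists theta, e, (fun i => a i); split.
- exact: unit_map_preserving.
- by move=> i.
- move=> i s t /(LambdaE D_inh)[Os si] Mt st.
  by have := lo s t Os Mt st; rewrite si; apply: le_trans; rewrite lerD2l lerN2.
- move=> i t Mt; rewrite -/(isum (Lambda xi n.+1 i.+1) _ (e t)).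
  by rewrite lastE => [|s []//]; rewrite upE// addrC; exact: up.
- move=> t Mt; rewrite -/(isum (OmegaN xi n.+1) _ (e t)) lastE// (isum_lsum D_inh).
  apply: le_trans (_ : \sum_(i < n.+1) (a i + delta / n.+1%:R) <= _).
    by apply: ler_sum => i _; exact: up.
  rewrite big_split /= sumr_const card_ord -[(delta / _) *+ _]mulr_natl.
  by rewrite mulrCA divff ?mulr1 ?gt_eqF// addrC.
Qed.
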